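(* Let $d=2$. Suppose the $\mathbb{Z}^2$ system is ergodic, $\mathbb{P}(\mathbf{0}\in\mathcal{W})>0$ (so that $\mathcal{W}$ has positive density almost surely), and almost surely every walk $X_z$, $z\in\mathcal{W}(\omega)$, satisfies: (1) $X_z$ has no loops, i.e. $X_z(\omega,i)\neq X_z(\omega,j)$ for $i\neq j$; (2) $X_z$ crosses every vertical line to the right of its starting point a last time and stays strictly to the right of it thereafter: for each $a\in\mathbb{Z}$ with $a>z\cdot e_1$ there is $k_0$ (depending on $a$ and $z$) such that $X_z(\omega,k_0)\cdot e_1=a$ and $X_z(\omega,k)\cdot e_1>a$ for every $k>k_0$. If we do not have almost sure coalescence, then with probability $1$ the set of bi-infinite points in $\mathcal{W}(\omega)$ has positive density (i.e. there is a positive density of bi-infinite trajectories in almost every configuration).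
   Context: $\mathbb{Z}^+=\{0,1,2,\dots\}$. $(\Omega,\mathcal{F},\mathbb{P},\{T^z\}_{z\in\mathbb{Z}^d})$ is a measure-preserving $\mathbb{Z}^d$ action on a probability space. $\mathcal{W}(\omega)\subset\mathbb{Z}^d$ is a measurable random set that is translation covariant, $\mathcal{W}(T^z\omega)=\mathcal{W}(\omega)-z$, with $\mathbb{P}(\mathbf{0}\in\mathcal{W})>0$. For $z\in\mathcal{W}(\omega)$, $X_z(\omega,\cdot):\mathbb{Z}^+\to\mathbb{Z}^d$ is a nearest-neighbor path with $X_z(\omega,0)=z$, measurable in $\omega$. Almost surely, for all $z\in\mathcal{W}(\omega)$, $x\in\mathbb{Z}^d$, $k\in\mathbb{Z}^+$, the walks are stationary, $X_z(\omega,k)=x+X_{z-x}(T^x\omega,k)$, and compatible, $X_z(\omega,k+1)=X_{X_z(\omega,1)}(\omega,k)$ (in particular $X_z(\omega,1)\in\mathcal{W}(\omega)$). Points $x,y\in\mathcal{W}(\omega)$ (or their walks) coalesce if $X_x(\omega,k_0)=X_y(\omega,k_1)$ for some $k_0,k_1\in\mathbb{Z}^+$. We have almost sure coalescence if almost surely all pairs $x,y\in\mathcal{W}(\omega)$ coalesce. A point $z$ is bi-infinite if there is a sequence $(a_n)_{n\ge0}$ in $\mathcal{W}(\omega)$ with $a_0=z$ and $X_{a_n}(\omega,i)=a_{n-i}$ for all $n\ge 1$, $0\le i\le n$. The union $\bigcup_{n}\bigcup_{i\ge0}\{X_{a_n}(\omega,i)\}$ is called a bi-infinite trajectory. A set $A\subset\mathbb{Z}^d$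 has density $c$ if $|A\cap[-N,N]^d|/(2N+1)^d\to c$ as $N\to\infty$. *)

(* Defs.v *)
From HB Require Import structures.
From mathcomp Require Import all_boot all_order all_algebra finmap.
From mathcomp Require Import all_classical all_reals all_analysis.
Set Implicit Arguments.
Unset Strict Implicit.
Unset Printing Implicit Defensive.
Import Order.TTheory GRing.Theory Num.Theory.
Import numFieldNormedType.Exports.
Local Open Scope classical_set_scope.
Local Open Scope ring_scope.

Notation Z2 := (int * int)%type.

Section density.

Definition box (N : nat) : set Z2 :=
  [set z | `|z.1| <= N%:Z /\ `|z.2| <= N%:Z].

(* [fset_set] is only meaningful on finite sets. *)
Lemma finite_box (N : nat) : finite_set (box N).
Proof.
have fin1 : finite_set [set i : int | `|i| <= N%:Z].
  apply: (@sub_finite_set _ _ ((fun k : nat => k%:Z - N%:Z) @` `I_(N + N).+1)).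
  - move=> i /=; rewrite ler_norml => /andP[lei leN].
    have i0 : 0 <= i + N%:Z by rewrite -lerBlDr sub0r.
    case E : (i + N%:Z) i0 => [k|//] _; exists k; last by rewrite -E addrK.
    by rewrite /= ltnS -lez_nat -E PoszD lerD2r.
  - exact: finite_image.
exact: (finite_setX fin1 fin1).
Qed.

Definition has_density (R : realType) (A : set Z2) (c : R) : Prop :=
  (fun N : nat => (#|` fset_set (A `&` box N)|)%:R / (N.*2.+1 ^ 2)%N%:R : R)
    @ \oo --> c.

Definition positive_density (R : realType) (A : set Z2) : Prop :=
  exists2 c : R, 0 < c & has_density A c.

End density.

Section Z2_action.
Context (R : realType) (d : measure_display) (Omega : measurableType d).
Variables (P : probability Omega R) (T : Z2 -> Omega -> Omega).

Definition measure_preserving_action : Prop :=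
  [/\ T 0 = id,
      forall x y, T (x + y) = T x \o T y,
      forall z, measurable_fun [set: Omega] (T z) &
      forall z A, measurable A -> P (T z @^-1` A) = P A].

Definition ergodic : Prop :=
  forall A, measurable A -> (forall z, T z @^-1` A = A) ->
    P A = 0%E \/ P A = 1%E.

End Z2_action.

(* The walk [X_z(w, .)] is meant only for [z] in [W w]; it is represented by a
   total function [X] whose value [X z w] is arbitrary when [z] is not in
   [W w], so every condition on [X z w] is restricted to [z] in [W w]. *)
Section walks.
Context (d : measure_display) (Omega : measurableType d).
Variables (T : Z2 -> Omega -> Omega) (W : Omega -> set Z2).
Variable X : Z2 -> Omega -> nat -> Z2.

Definition measurable_random_set : Prop :=
  forall z, measurable [set w | W w z].

Definition translation_covariant : Prop :=
  forall z w, W (T z w) = [set x - z | x in W w].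

Definition measurable_walks : Prop :=
  forall z k y, measurable [set w | W w z /\ X z w k = y].

Definition adjacent (x y : Z2) : Prop :=
  `|x.1 - y.1| + `|x.2 - y.2| = 1.

Definition nearest_neighbor_walks : Prop :=
  forall w z, W w z ->
    X z w 0%N = z /\ forall k, adjacent (X z w k) (X z w k.+1).

Definition stationary_at (w : Omega) : Prop :=
  forall z x k, W w z -> X z w k = x + X (z - x) (T x w) k.

Definition compatible_at (w : Omega) : Prop :=
  forall z k, W w z ->
    W w (X z w 1%N) /\ X z w k.+1 = X (X z w 1%N) w k.

Definition coalesce (w : Omega) (x y : Z2) : Prop :=
  exists k0 k1, X x w k0 = X y w k1.

Definition bi_infinite (w : Omega) (z : Z2) : Prop :=
  exists a : nat -> Z2,
    [/\ forall n, W w (a n),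
        a 0%N = z &
        forall n i, (1 <= n)%N -> (i <= n)%N -> X (a n) w i = a (n - i)%N].

Definition no_loops (w : Omega) (z : Z2) : Prop :=
  forall i j, i <> j -> X z w i <> X z w j.

Definition last_crossings (w : Omega) (z : Z2) : Prop :=
  forall a : int, z.1 < a ->
    exists k0, (X z w k0).1 = a /\ forall k, (k0 < k)%N -> a < (X z w k).1.

End walks.

Definition almost_sure_coalescence (R : realType) (d : measure_display)
    (Omega : measurableType d) (P : probability Omega R)
    (W : Omega -> set Z2) (X : Z2 -> Omega -> nat -> Z2) : Prop :=
  {ae P, forall w, forall x y, W w x -> W w y -> coalesce X w x y}.

(* Main.v *)
(* Call a point of [W] an exit point if its walk stays strictly to the right of
   its column after time 0, and call an exit point a boundary point if it
   coalesces with no exit point below it on its column.  By planarity, an exit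
   point lying between two coalescing exit points of the same column coalesces
   with them.  Hence, if two walks do not coalesce, then on a column to their
   right the class of the upper one is bounded below by the lower one, so it has
   a lowest point; thus the origin is a boundary point with probability
   [delta > 0].  Distinct boundary points of one column do not coalesce, so they
   reach the column [n] steps to the right at distinct points, and mass
   transport shows that the origin is reached from distance at least [n] with
   probability at least [delta], for every [n].  Letting [n] tend to infinity,
   Koenig's lemma makes the origin bi-infinite with probability at least
   [delta].  The pointwise ergodic theorem on boxes turns this probability into
   a density; it follows from Garsia's maximal inequality applied in each of
   the two coordinate directions, ergodicity being used only at the end. *)

Require Import Defs.
From HB Require Import structures.
From mathcomp Require Import all_boot all_order all_algebra finmap.
From mathcomp Require Import all_classical all_reals all_analysis.
From mathcomp Require Import measurable_realfun.
From mathcomp Require Import zify lra ring.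
Import Order.TTheory GRing.Theory Num.Theory.
Import numFieldNormedType.Exports.
Local Open Scope classical_set_scope.
Local Open Scope ring_scope.
Set Implicit Arguments.
Unset Strict Implicit.
Unset Printing Implicit Defensive.

(** * Crossing numbers of lattice paths *)

(* The signed number of times the edge from [q] to [q'] crosses the leftward
   half-line issued from [v + (0, 1/2)]. *)
Definition crossing (v q q' : Z2) : int :=
  if q.1 <= v.1 then (v.2 < q'.2)%R%:Z - (v.2 < q.2)%R%:Z else 0.

Definition crossings (p : nat -> Z2) (n : nat) (v : Z2) : int :=
  \sum_(k < n) crossing v (p k) (p k.+1).

(** Indicator of the leftward row of lattice points issued from [v] itself, which lies halfway
    between two consecutive half-lines counted by [crossing]. *)
Definition on_ray (v q : Z2) : int := ((q.1 <= v.1)%R && (q.2 == v.2))%:Z.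

(** The two half-lines differ by a unit segment at half-integer height. An edge crossing only one of
    them is vertical in the column [v.1 + 1] and has [(v.1 + 1, v.2)] as an endpoint. *)
Lemma crossing_right v q q' : Defs.adjacent q q' ->
  q <> (v.1 + 1, v.2) -> q' <> (v.1 + 1, v.2) ->
  crossing (v.1 + 1, v.2) q q' = crossing v q q'.
Proof.
case: v q q' => [x y] [q1 q2] [r1 r2]; rewrite /Defs.adjacent /crossing /= => adj.
move=> /eqP + /eqP; rewrite !xpair_eqE => n1 n2; do ?case: ifP => ?; lia.
Qed.

(** The two half-lines enclose one row of lattice points. Its open end can be passed only through
    its tip, which the edge avoids, so the difference counts entries into the row minus exits. *)
Lemma crossing_up v q q' : Defs.adjacent q q' ->
  q <> (v.1, v.2 + 1) -> q' <> (v.1, v.2 + 1) ->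
  crossing v q q' - crossing (v.1, v.2 + 1) q q' =
  on_ray (v.1, v.2 + 1) q' - on_ray (v.1, v.2 + 1) q.
Proof.
case: v q q' => [x y] [q1 q2] [r1 r2].
rewrite /Defs.adjacent /crossing /on_ray /= => adj.
move=> /eqP + /eqP; rewrite !xpair_eqE => n1 n2; do ?case: ifP => ?; lia.
Qed.

Lemma crossings_right p n v : (forall k, Defs.adjacent (p k) (p k.+1)) ->
  (forall k, p k <> (v.1 + 1, v.2)) ->
  crossings p n (v.1 + 1, v.2) = crossings p n v.
Proof. by move=> adj off; apply: eq_bigr => k _; apply: crossing_right. Qed.

Lemma crossings_up p n v : (forall k, Defs.adjacent (p k) (p k.+1)) ->
  (forall k, p k <> (v.1, v.2 + 1)) ->
  crossings p n v - crossings p n (v.1, v.2 + 1) =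
  on_ray (v.1, v.2 + 1) (p n) - on_ray (v.1, v.2 + 1) (p 0%N).
Proof.
move=> adj off; rewrite /crossings -sumrB.
rewrite -(telescope_sumr (fun k => on_ray (v.1, v.2 + 1) (p k)) (leq0n n)).
by rewrite big_mkord; apply: eq_bigr => k _; apply: crossing_up.
Qed.

(** As every edge starts in a column at most [v.1], the half-line acts as a full horizontal line and
    the sum telescopes. *)
Lemma crossings_far p n (v : Z2) : (forall k, (k < n)%N -> (p k).1 <= v.1) ->
  crossings p n v = (v.2 < (p n).2)%R%:Z - (v.2 < (p 0%N).2)%R%:Z.
Proof.
move=> far; rewrite -(telescope_sumr (fun k => (v.2 < (p k).2)%R%:Z) (leq0n n)).
by rewrite big_mkord; apply: eq_bigr => k _; rewrite /crossing far.
Qed.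

(** Only the first edge starts in the column of [v]; it moves right, hence is horizontal and crosses
    nothing. *)
Lemma crossings_start p n (v : Z2) : (forall k, Defs.adjacent (p k) (p k.+1)) ->
  (forall k, (0 < k)%N -> (p 0%N).1 < (p k).1) -> v.1 = (p 0%N).1 ->
  crossings p n v = 0.
Proof.
move=> adj right v1; apply: big1 => -[[|k] kn] _ /=; rewrite /crossing v1.
  rewrite lexx; have := adj 0%N; have := right 1%N isT.
  by rewrite /Defs.adjacent; lia.
by have := right k.+1 isT; rewrite ltNge => /negbTE ->.
Qed.

(** A discrete Jordan curve argument: [q] starts inside a loop made from [p] and [r] and has to
    leave it in order to run off to the right. *)
Lemma sandwiched_path_meets (p q r : nat -> Z2) (a : int) (i j : nat) :
    (forall k, Defs.adjacent (p k) (p k.+1)) ->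
    (forall k, Defs.adjacent (q k) (q k.+1)) ->
    (forall k, Defs.adjacent (r k) (r k.+1)) ->
    (p 0%N).1 = a -> (q 0%N).1 = a -> (r 0%N).1 = a ->
    (forall k, (0 < k)%N -> a < (p k).1) ->
    (forall k, (0 < k)%N -> a < (q k).1) ->
    (forall k, (0 < k)%N -> a < (r k).1) ->
    (p 0%N).2 < (q 0%N).2 < (r 0%N).2 ->
    p i = r j -> (forall x, exists k, x < (q k).1) ->
  exists k l, q k = p l \/ q k = r l.
Proof.
move=> adjp adjq adjr p0 q0 r0 rp rq rr /andP[pq qr] pr escape.
apply: contrapT => /forallNP nomeet.
have offp k l : p l <> q k by move=> e; apply: (nomeet k); exists l; left.
have offr k l : r l <> q k by move=> e; apply: (nomeet k); exists l; right.
have qa k : a <= (q k).1.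
  by case: k => [|k]; [rewrite q0|exact/ltW/rq].
(* [- I v] is the winding number around [v] of the loop made of [p], of [r]
   reversed and of a segment pushed slightly to the left of the column [a].  It
   is constant along [q], which starts inside the loop and ends outside. *)
pose I v : int := crossings p i v - crossings r j v -
  ((p 0%N).2 <= v.2 < (r 0%N).2)%R%:Z.
have Iright v : (forall l, p l <> (v.1 + 1, v.2)) ->
    (forall l, r l <> (v.1 + 1, v.2)) -> I (v.1 + 1, v.2) = I v.
  by move=> op or; rewrite /I !crossings_right.
have Iup v : a <= v.1 -> (forall l, p l <> (v.1, v.2 + 1)) ->
    (forall l, r l <> (v.1, v.2 + 1)) -> I (v.1, v.2 + 1) = I v.
  move=> av op or; rewrite /I.
  (* The common endpoint [p i = r j] cancels, and the two starting points are compensated by the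
     ends of the closing segment. *)
  have := crossings_up i adjp op; have := crossings_up j adjr or.
  rewrite pr /on_ray p0 r0 av /=; lia.
have Istep k : I (q k.+1) = I (q k).
  have adj := adjq k; have qak := qa k; have qak1 := qa k.+1.
  have op l := offp k l; have op1 l := offp k.+1 l.
  have or l := offr k l; have or1 l := offr k.+1 l.
  move: adj qak qak1 op op1 or or1; rewrite /Defs.adjacent.
  case: (q k) (q k.+1) => [x y] [x' y'] /= adj ax ax' op op1 or or1.
  have [[ex ey]|[[ex ey]|[[ex ey]|[ex ey]]]] : (x' = x + 1 /\ y' = y) \/
      (x = x' + 1 /\ y' = y) \/ (x' = x /\ y' = y + 1) \/ (x' = x /\ y = y' + 1).
    by lia.
  - by subst; apply: (Iright (x, y)).
  - by subst; rewrite -(Iright (x', y)).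
  - by subst; apply: (Iup (x, y)).
  - by subst; rewrite -(Iup (x, y')).
have Iq k : I (q k) = I (q 0%N) by elim: k => // k <-.
have I0 : I (q 0%N) = -1.
  rewrite /I (@crossings_start p) ?p0 ?q0 //.
  rewrite (@crossings_start r) ?r0 ?q0 //.
  by rewrite (ltW pq) qr.
(* The sum dominates the first coordinates of all points of both arcs except their common end, as
   [crossings_far] requires at [q k]. *)
have [k kfar] := escape (\sum_(k < i) `|(p k).1| + \sum_(k < j) `|(r k).1|).
have bound (s : nat -> Z2) n l : (l < n)%N -> (s l).1 <= \sum_(k < n) `|(s k).1|.
  move=> ln; rewrite (bigD1 (Ordinal ln)) //=; apply: le_trans (ler_norm _) _.
  by rewrite lerDl sumr_ge0.
have sp n (s : nat -> Z2) : 0 <= \sum_(k < n) `|(s k).1| by apply: sumr_ge0.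
have := Iq k; rewrite I0 /I (@crossings_far p); last first.
  move=> l li; apply: le_trans (bound p i l li) _; apply: ltW.
  by apply: le_lt_trans kfar; rewrite lerDl.
rewrite (@crossings_far r); last first.
  move=> l li; apply: le_trans (bound r j l li) _; apply: ltW.
  by apply: le_lt_trans kfar; rewrite lerDr.
(* So far to the right, the two crossing numbers differ by exactly the indicator of the segment, so
   [I (q k)] is 0 and not -1. *)
rewrite pr; move: (r j) => [] /=; lia.
Qed.

(** * The pointwise ergodic theorem on boxes *)

Section limsup.
Context {R : realType}.
Implicit Types (u v : nat -> R).

Definition in01 (I : Type) (f : I -> R) : Prop := forall i, 0 <= f i <= 1.

Lemma in01_has_ubound u : in01 u -> has_ubound (range u).
Proof. by move=> u01; exists 1 => _ [n _ <-]; case/andP: (u01 n). Qed.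

Lemma in01_has_lbound u : in01 u -> has_lbound (range u).
Proof. by move=> u01; exists 0 => _ [n _ <-]; case/andP: (u01 n). Qed.

Lemma le_sups u m n : in01 u -> (m <= n)%N -> u n <= sups u m.
Proof.
move=> u01 mn; apply: ub_le_sup; last by exists n.
exact/has_ubound_sdrop/in01_has_ubound.
Qed.

Lemma sups_le u m (c : R) : (forall n, (m <= n)%N -> u n <= c) -> sups u m <= c.
Proof.
by move=> h; apply: ge_sup => [|_ [n mn <-]]; [exists (u m), m => /=|exact: h].
Qed.

Lemma in01_sups u : in01 u -> in01 (sups u).
Proof.
move=> u01 n; rewrite sups_le ?andbT; last by move=> k _; case/andP: (u01 k).
by case/andP: (u01 n) => h _; apply: le_trans h (le_sups u01 (leqnn n)).
Qed.

Lemma cvg_sups_limn_sup u : in01 u -> sups u @ \oo --> limn_sup u.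
Proof.
move=> u01; have := cvg_sups_inf (in01_has_ubound u01) (in01_has_lbound u01).
by move=> c; rewrite /limn_sup (cvg_lim _ c).
Qed.

Lemma limn_sup_le_sups u n : in01 u -> limn_sup u <= sups u n.
Proof.
move=> u01; apply: nonincreasing_cvgn_ge.
  exact/nonincreasing_sups/in01_has_ubound.
by apply/cvg_ex; exists (limn_sup u); exact: cvg_sups_limn_sup.
Qed.

Lemma limn_sup_le u (c : R) : in01 u ->
  (forall e : R, 0 < e -> \forall n \near \oo, u n <= c + e) ->
  (limn_sup u : R) <= c.
Proof.
move=> u01 h; apply/ler_addgt0Pr => e e0; have [N _ hN] := h e e0.
apply: le_trans (limn_sup_le_sups N u01) _.
by apply: sups_le => n Nn; apply: hN.
Qed.

Lemma near_le_limn_sup u (e : R) : in01 u -> 0 < e ->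
  \forall n \near \oo, u n <= (limn_sup u : R) + e.
Proof.
move=> u01 e0; have /cvgrPdist_lt/(_ e e0) := cvg_sups_limn_sup u01.
apply: filterS => n; rewrite distrC => /ltr_distlDr /ltW; apply: le_trans.
exact: le_sups.
Qed.

Lemma frequently_limn_sup_lt u (e : R) : in01 u -> 0 < e ->
  exists n, (limn_sup u : R) - e < u n.
Proof.
move=> u01 e0; apply: contrapT => /forallNP h.
suff : (limn_sup u : R) <= (limn_sup u : R) - e by rewrite lerBrDr gerDl leNgt e0.
apply: limn_sup_le => // x x0; apply: nearW => n.
by have /negP := h n; rewrite -leNgt => /le_trans; apply; rewrite lerDl ltW.
Qed.

Lemma in01_limn_sup u : in01 u -> 0 <= limn_sup u <= 1.
Proof.
move=> u01; apply/andP; split.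
  have c := cvg_sups_limn_sup u01; rewrite -(cvg_lim _ c) //.
  apply: limr_ge; first by apply/cvg_ex; exists (limn_sup u).
  by apply: nearW => n; case/andP: (in01_sups u01 n).
by apply: limn_sup_le => // e e0; apply: nearW => n; case/andP: (u01 n); lra.
Qed.

Lemma near_natV_lt (e c : R) : 0 < e -> \forall n \near \oo, c / n.+1%:R < e.
Proof.
move=> e0; have : (fun n => c * harmonic n) @ \oo --> c * 0.
  exact: cvgMr cvg_harmonic.
rewrite mulr0 => /cvgrPdist_lt /(_ e e0); apply: filterS => n.
by rewrite sub0r normrN => /(le_lt_trans (ler_norm _)).
Qed.

End limsup.

(** * Means of bounded measurable functions *)

Section mean.
Context {R : realType} {d : measure_display} {Omega : measurableType d}.
Variable P : probability Omega R.
Implicit Types f g : Omega -> R.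

Definition bounded_measurable f : Prop :=
  measurable_fun [set: Omega] f /\ exists C, forall w, `|f w| <= C.

Local Notation bm := bounded_measurable.
Local Notation mean f := (Rintegral P [set: Omega] f).

Lemma bm_integrable f : bm f -> P.-integrable [set: Omega] (EFin \o f).
Proof.
move=> [mf [C fC]]; apply: measurable_bounded_integrable => //.
  exact: le_lt_trans (probability_le1 P measurableT) (ltry 1).
exists C; split => [|x Cx w _]; first exact: num_real.
exact: le_trans (fC w) (ltW Cx).
Qed.

Lemma bm_cst (c : R) : bm (fun=> c).
Proof. by split; [exact: measurable_cst|exists `|c|]. Qed.

Lemma bmD f g : bm f -> bm g -> bm (fun w => f w + g w).
Proof.
move=> [mf [C fC]] [mg [D gD]]; split; first exact: measurable_funD.
by exists (C + D) => w; apply: le_trans (ler_normD _ _) _; exact: lerD.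
Qed.

Lemma bmB f g : bm f -> bm g -> bm (fun w => f w - g w).
Proof.
move=> [mf [C fC]] [mg [D gD]]; split; first exact: measurable_funB.
by exists (C + D) => w; apply: le_trans (ler_normB _ _) _; exact: lerD.
Qed.

Lemma bmZ (c : R) f : bm f -> bm (fun w => c * f w).
Proof.
move=> [mf [C fC]]; split; first exact: measurable_funM.
by exists (`|c| * C) => w; rewrite normrM ler_wpM2l.
Qed.

Lemma bm_max f g : bm f -> bm g -> bm (fun w => Num.max (f w) (g w)).
Proof.
move=> [mf [C fC]] [mg [D gD]]; split; first exact: measurable_maxr.
exists (C + D) => w; have [_|_] := leP (f w) (g w).
  by apply: le_trans (gD w) _; rewrite lerDr (le_trans _ (fC w)).
by apply: le_trans (fC w) _; rewrite lerDl (le_trans _ (gD w)).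
Qed.

Lemma bm_comp (S : Omega -> Omega) f : measurable_fun [set: Omega] S -> bm f ->
  bm (fun w => f (S w)).
Proof.
move=> mS [mf [C fC]]; split; last by exists C.
by apply: (measurable_comp (F := [set: Omega])).
Qed.

Lemma bm_sum n (F : nat -> Omega -> R) : (forall k, bm (F k)) ->
  bm (fun w => \sum_(k < n) F k w).
Proof.
move=> bF; elim: n => [|n IH].
  by under eq_fun do rewrite big_ord0; exact: bm_cst.
by under eq_fun do rewrite big_ord_recr /=; exact: bmD.
Qed.

Lemma bm_indic (A : set Omega) : measurable A -> bm (\1_A).
Proof.
move=> mA; split; first exact: measurable_indic.
by exists 1 => w; rewrite indicE; case: (_ \in _) => /=; rewrite ?normr1 ?normr0.
Qed.

Lemma bm_in01 f : measurable_fun [set: Omega] f -> in01 f -> bm f.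
Proof.
move=> mf f01; split => //; exists 1 => w.
by case/andP: (f01 w) => f0 f1; rewrite ger0_norm.
Qed.

Lemma meanD f g : bm f -> bm g -> mean (fun w => f w + g w) = mean f + mean g.
Proof. by move=> /bm_integrable bf /bm_integrable bg; rewrite RintegralD. Qed.

Lemma meanB f g : bm f -> bm g -> mean (fun w => f w - g w) = mean f - mean g.
Proof. by move=> /bm_integrable bf /bm_integrable bg; rewrite RintegralB. Qed.

Lemma meanZ (c : R) f : bm f -> mean (fun w => c * f w) = c * mean f.
Proof. by move=> /bm_integrable bf; rewrite RintegralZl. Qed.

Lemma mean_cst (c : R) : mean (fun=> c) = c.
Proof.
rewrite Rintegral_cst // [X in fine X](_ : _ = 1%E) ?mulr1 //.
exact: probability_setT.
Qed.

Lemma mean_le f g : bm f -> bm g -> (forall w, f w <= g w) -> mean f <= mean g.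
Proof. by move=> /bm_integrable ? /bm_integrable ? fg; apply: le_Rintegral. Qed.

Lemma mean_indic (A : set Omega) : measurable A -> mean (\1_A) = fine (P A).
Proof. by move=> mA; rewrite /Rintegral integral_indic // setIT. Qed.

Lemma mean_comp (S : Omega -> Omega) f : measurable_fun [set: Omega] S ->
  (forall A, measurable A -> P (S @^-1` A) = P A) ->
  bm f -> mean (fun w => f (S w)) = mean f.
Proof.
move=> mS PS bf; rewrite /Rintegral; congr fine.
have mf : measurable_fun [set: Omega] (EFin \o f).
  by apply/measurable_EFinP; case: bf.
have iS : P.-integrable (S @^-1` [set: Omega]) ((EFin \o f) \o S).
  rewrite preimage_setT; exact: (bm_integrable (bm_comp mS bf)).
have := integral_pushforward mS mf iS measurableT; rewrite preimage_setT.
move=> <-; apply: eq_measure_integral => A mA _; exact: PS.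
Qed.

Lemma mean_cvg (F : nat -> Omega -> R) f (C : R) :
  (forall n, measurable_fun [set: Omega] (F n)) -> (forall n w, `|F n w| <= C) ->
  bm f -> (forall w, F ^~ w @ \oo --> f w) ->
  (fun n => mean (F n)) @ \oo --> mean f.
Proof.
move=> mF FC [mf [D fD]] cF.
have bF n : bm (F n) by split => //; exists C => w; exact: FC.
have := @dominated_convergence _ _ _ P [set: Omega] measurableT
  (fun n => EFin \o F n) (EFin \o f) (cst C%:E).
case.
- by move=> n; apply/measurable_EFinP.
- by apply/measurable_EFinP.
- by apply: aeW => w _; apply: cvg_EFin; [exact: nearW|exact: cF].
- exact: (bm_integrable (bm_cst C)).
- by apply: aeW => w n _; rewrite /= lee_fin.
move=> _ _ h; apply: (fine_cvg (a := mean f)).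
rewrite /Rintegral fineK; first exact: h.
by apply: integrable_fin_num => //; apply: bm_integrable; split => //; exists D.
Qed.

End mean.

(** * Garsia's maximal inequality and one-sided averages *)

Section maximal.
Context {R : realType} {d : measure_display} {Omega : measurableType d}.
Variable P : probability Omega R.

Local Notation bm := bounded_measurable.
Local Notation mean f := (Rintegral P [set: Omega] f).

Definition preserves (S : Omega -> Omega) : Prop :=
  measurable_fun [set: Omega] S /\
  forall A, measurable A -> P (S @^-1` A) = P A.

Definition average (S : Omega -> Omega) (n : nat) (f : Omega -> R)
    (w : Omega) : R :=
  (\sum_(k < n.+1) f (iter k S w)) / n.+1%:R.

Lemma preserves_iter S k : preserves S -> preserves (iter k S).
Proof.
move=> [mS PS]; elim: k => [|k [mk Pk]]; first by split => //; exact: measurable_id.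
split; first exact: (measurable_comp (F := [set: Omega])).
move=> A mA; rewrite -[RHS]PS // -[RHS]Pk //.
by rewrite -[X in measurable X]setTI; exact: mS.
Qed.

Lemma mean_preserves S f : preserves S -> bm f -> mean (fun w => f (S w)) = mean f.
Proof. by move=> [mS PS]; exact: mean_comp. Qed.

Lemma bm_average S n f : preserves S -> bm f -> bm (average S n f).
Proof.
move=> pS bf; rewrite /average.
under eq_fun do rewrite mulrC.
apply/bmZ/(@bm_sum _ _ _ _ (fun k w => f (iter k S w))) => k.
by apply: bm_comp => //; have [] := preserves_iter k pS.
Qed.

Lemma in01_average S n f w : in01 f -> 0 <= average S n f w <= 1.
Proof.
move=> f01; rewrite /average divr_ge0 ?sumr_ge0 //=; last first.
  by move=> k _; case/andP: (f01 (iter k S w)).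
rewrite ler_pdivrMr ?ltr0n // mul1r.
apply: (@le_trans _ _ (\sum_(k < n.+1) 1)).
  by apply: ler_sum => k _; case/andP: (f01 (iter k S w)).
by rewrite sumr_const card_ord.
Qed.

(* The maximum of the Birkhoff sums of [g] over the times [0, .., n]. *)
Fixpoint running_max (S : Omega -> Omega) (g : Omega -> R) (n : nat)
    (w : Omega) : R :=
  if n is m.+1 then Num.max 0 (g w + running_max S g m (S w)) else 0.

Section running_max.
Variables (S : Omega -> Omega) (g : Omega -> R).
Local Notation M := (running_max S g).

Lemma running_max_ge0 n w : 0 <= M n w.
Proof. by case: n => //= n; rewrite le_max lexx. Qed.

Lemma running_max_homo m n w : (m <= n)%N -> M m w <= M n w.
Proof.
suff h k v : M k v <= M k.+1 v.
  move=> mn; elim: n mn => [|n IH]; first by rewrite leqn0 => /eqP ->.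
  rewrite leq_eqVlt => /predU1P[-> //|]; rewrite ltnS => /IH/le_trans; apply.
  exact: h.
elim: k v => [|k IH] v; first exact: running_max_ge0.
by rewrite /= ge_max !le_max lexx /= lerD2l IH orbT.
Qed.

Lemma sum_le_running_max n w : \sum_(k < n) g (iter k S w) <= M n w.
Proof.
elim: n w => [|n IH] w; first by rewrite big_ord0.
rewrite big_ord_recl /= le_max lerD2l; apply/orP; right.
by under eq_bigr do rewrite /bump /= add0n -iterS iterSr; exact: IH.
Qed.

Lemma bm_running_max n : preserves S -> bm g -> bm (M n).
Proof.
move=> pS bg; elim: n => [|n IH]; first exact: bm_cst.
apply: (bm_max (bm_cst 0)); apply: bmD => //; apply: bm_comp => //.
by case: pS.
Qed.

(* Garsia's argument: where [M n.+1] is positive it equals [g + M n \o S], so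
   [g >= M n - M n \o S] there, and the right-hand side has mean 0. *)
Lemma maximal_ergodic : preserves S -> bm g -> (forall w, -1 <= g w) ->
  (forall w, exists n, 0 < \sum_(k < n) g (iter k S w)) -> 0 <= mean g.
Proof.
move=> pS bg g1 gpos.
pose Z n := [set w | M n.+1 w = 0].
have mZ n : measurable (Z n).
  have [mM _] := bm_running_max n.+1 pS bg.
  have := mM measurableT [set 0] (measurable_set1 0); rewrite setTI; exact.
(* On [Z n] the value [M n w] vanishes as well, and the added indicator compensates for
   [g w >= -1]. *)
have step n : 0 <= mean g + fine (P (Z n)).
  have bI := bm_indic (mZ n); have bM := bm_running_max n pS bg.
  have bMS : bm (fun w => M n (S w)) by apply: bm_comp => //; case: pS.
  rewrite -mean_indic // -meanD //.
  rewrite -[leLHS](subrr (mean (M n))) -[X in _ - X](mean_preserves pS bM) -meanB //.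
  apply: mean_le; [exact: bmB|exact: bmD|move=> w].
  have := running_max_homo w (leqnSn n); have := running_max_ge0 n (S w).
  have := g1 w; rewrite indicE; have [/set_mem|/negP wZ] := boolP (w \in Z n).
    by rewrite /Z /=; lra.
  have : M n.+1 w <> 0 by move=> h; apply: wZ; exact: mem_set.
  by rewrite mulr0n addr0 /=; case: (leP 0 (g w + _)) => [_ _ _ _|_ /(_ erefl)] //; lra.
(* Every point has a positive Birkhoff sum, so the decreasing events [Z n] have empty intersection
   and the correction term tends to 0. *)
have Z0 : \bigcap_n Z n = set0.
  rewrite -subset0 => w Zw; have [n] := gpos w; rewrite ltNge => /negP; apply.
  rewrite -[leRHS](Zw n I); apply: le_trans (sum_le_running_max _ _) _.
  exact: running_max_homo.
have Zcvg : (fun n => fine (P (Z n))) @ \oo --> (0 : R).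
  apply: (fine_cvg (a := 0)); have -> : 0%:E = P (\bigcap_n Z n) by rewrite Z0 measure0.
  apply: nonincreasing_cvg_mu => //.
  - by apply: le_lt_trans (ltry 1); exact: probability_le1.
  - by rewrite Z0.
  - move=> m n mn; apply/subsetPset => w e.
    apply/le_anti/andP; split; last exact: running_max_ge0.
    by rewrite -[leRHS]e; exact: running_max_homo.
have : (fun n => mean g + fine (P (Z n))) @ \oo --> mean g + 0.
  by apply: cvgD => //; exact: cvg_cst.
rewrite addr0 => c; rewrite -(cvg_lim _ c) //; apply: limr_ge.
  by apply/cvg_ex; exists (mean g).
exact: nearW.
Qed.

End running_max.

(** The maximal inequality is applied to [f + e - h]. As [h] is invariant, the Birkhoff sums of this
    function are positive multiples of [average S n f + e - h], and one of them is positive at every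
    point; the lower bound -1 comes from [f >= 0] and [h <= 1]. *)
Lemma mean_le_of_average S f h e : preserves S -> 
  measurable_fun [set: Omega] f -> in01 f -> measurable_fun [set: Omega] h -> in01 h ->
  0 < e -> (forall w, h (S w) = h w) ->
  (forall w, exists n, h w - e < average S n f w) -> mean h <= mean f + e.
Proof.
move=> pS mf f01 mh h01 e0 hS large.
have [bf bh] := (bm_in01 mf f01, bm_in01 mh h01).
pose g w := f w + e - h w.
have bfe : bm (fun w => f w + e) by apply: bmD => //; exact: bm_cst.
have bg : bm g by exact: bmB.
suff : 0 <= mean g.
  by rewrite /g (meanB P bfe bh) (meanD P bf (bm_cst e)) mean_cst subr_ge0.
apply: (@maximal_ergodic S) => // w.
  by rewrite /g; move: (f01 w) (h01 w); lra.
have [n] := large w; rewrite /average ltr_pdivlMr ?ltr0n // => hn.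
exists n.+1; rewrite /g sumrB big_split /= !sumr_const card_ord.
have hk k : h (iter k S w) = h w by elim: k => //= k <-; rewrite hS.
rewrite [X in _ - X](eq_bigr (fun=> h w)) //.
rewrite sumr_const card_ord -(mulr_natr e) -(mulr_natr (h w)).
by move: hn; rewrite mulrBl; lra.
Qed.

Lemma limn_sup_near_eq (u v : nat -> R) : in01 u -> in01 v ->
  (forall n, `|u n - v n| <= n.+1%:R^-1) -> limn_sup u = limn_sup v.
Proof.
suff h (u' v' : nat -> R) : in01 u' -> in01 v' ->
    (forall n, `|u' n - v' n| <= n.+1%:R^-1) -> (limn_sup u' : R) <= limn_sup v'.
  move=> u01 v01 uv; apply/eqP; rewrite eq_le !h // => n.
  by rewrite distrC.
move=> u01 v01 uv; apply: limn_sup_le => // e e0.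
have e20 : 0 < e / 2 by rewrite divr_gt0.
near=> n.
have h1 : v' n <= (limn_sup v' : R) + e / 2.
  by near: n; exact: near_le_limn_sup.
have h2 : 1 / n.+1%:R < e / 2 by near: n; exact: near_natV_lt.
rewrite (splitr e) addrA; apply: le_trans (lerD h1 (lexx _)).
have := uv n; rewrite ler_norml; move: h2; rewrite div1r.
set x := _^-1; set y := e / 2; lra.
Unshelve. all: by end_near. Qed.

Lemma average_shift S n f w : in01 f ->
  `|average S n f (S w) - average S n f w| <= n.+1%:R^-1.
Proof.
move=> f01; rewrite /average -mulrBl normrM.
rewrite [X in _ * X]ger0_norm ?invr_ge0 // ler_piMl ?invr_ge0 //.
under eq_bigr do rewrite -iterSr.
rewrite -sumrB -(big_mkord predT (fun k => f (iter k.+1 S w) - f (iter k S w))).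
rewrite telescope_sumr //=; have := f01 w; have := f01 (S (iter n S w)).
rewrite ler_norml; lra.
Qed.

Lemma measurable_average S n f : preserves S -> in01 f ->
  measurable_fun [set: Omega] f -> measurable_fun [set: Omega] (average S n f).
Proof. by move=> pS f01 mf; have [] := bm_average n pS (bm_in01 mf f01). Qed.

Definition limsup_fun (F : nat -> Omega -> R) (w : Omega) : R :=
  limn_sup (fun n => F n w).

Lemma in01_limsup_fun F : (forall n, in01 (F n)) -> in01 (limsup_fun F).
Proof. by move=> F01 w; apply: in01_limn_sup => n; exact: F01. Qed.

Lemma measurable_limsup_fun F : (forall n, in01 (F n)) ->
  (forall n, measurable_fun [set: Omega] (F n)) ->
  measurable_fun [set: Omega] (limsup_fun F).
Proof.
move=> F01 mF; apply: measurable_fun_limn_sup => // w _.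
  by apply: in01_has_ubound => n; exact: F01.
by apply: in01_has_lbound => n; exact: F01.
Qed.

(** One half of Birkhoff's theorem: the upper limit of the averages is [S]-invariant and is
    approached within [e] at some time, so it can serve as [h] in [mean_le_of_average]. *)
Lemma mean_limsup_average S f : preserves S -> in01 f ->
  measurable_fun [set: Omega] f ->
  mean (limsup_fun (fun n => average S n f)) <= mean f.
Proof.
move=> pS f01 mf; apply/ler_addgt0Pr => e e0.
have a01 n : in01 (average S n f) by move=> w; exact: in01_average.
have ma n := measurable_average n pS f01 mf.
apply: (@mean_le_of_average S) => //.
- exact: measurable_limsup_fun.
- exact: in01_limsup_fun.
- move=> w; apply: limn_sup_near_eq; try by move=> n; exact: a01.
  by move=> n; exact: average_shift.
- by move=> w; apply: frequently_limn_sup_lt => // n; exact: a01.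
Qed.

End maximal.

(** * Averages over symmetric time windows *)

Section two_sided.
Context {R : realType} {d : measure_display} {Omega : measurableType d}.
Variable P : probability Omega R.
Implicit Types (S : Omega -> Omega) (f : Omega -> R).

Local Notation mean f := (Rintegral P [set: Omega] f).

(* [S'] plays the role of the inverse of [S]. *)
Definition two_sided S S' (n : nat) f (w : Omega) : R :=
  (\sum_(k < n.+1) f (iter k S w) + \sum_(k < n) f (iter k.+1 S' w))
  / n.*2.+1%:R.

Let size_gt0 (n : nat) : 0 < (n.*2.+1%:R : R). Proof. by rewrite ltr0n. Qed.

Let sum_cst (n : nat) (c : R) : \sum_(k < n) c = n%:R * c.
Proof. by rewrite sumr_const card_ord mulr_natl. Qed.

Lemma two_sided_cst S S' n (c : R) w : two_sided S S' n (fun=> c) w = c.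
Proof.
rewrite /two_sided !sum_cst -mulrDl -natrD addSn addnn mulrC mulKf //.
Qed.

Lemma two_sidedB S S' n f g w : two_sided S S' n (fun v => f v - g v) w =
  two_sided S S' n f w - two_sided S S' n g w.
Proof. by rewrite /two_sided !sumrB -mulrBl; congr (_ / _); ring. Qed.

Lemma two_sided_le S S' n f g w : (forall v, f v <= g v) ->
  two_sided S S' n f w <= two_sided S S' n g w.
Proof.
by move=> fg; rewrite ler_pM2r ?invr_gt0 //; apply: lerD; apply: ler_sum.
Qed.

Lemma in01_two_sided S S' n f : in01 f -> in01 (two_sided S S' n f).
Proof.
move=> f01 w; rewrite -[X in X <= _ <= _](two_sided_cst S S' n 0 w).
rewrite -[X in _ <= _ <= X](two_sided_cst S S' n 1 w).
by rewrite !two_sided_le // => v; case/andP: (f01 v).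
Qed.

Lemma measurable_two_sided S S' n f : preserves P S -> preserves P S' ->
  in01 f -> measurable_fun [set: Omega] f ->
  measurable_fun [set: Omega] (two_sided S S' n f).
Proof.
move=> pS pS' f01 mf; have bf := bm_in01 mf f01.
have b1 k : bounded_measurable (fun w => f (iter k S w)).
  by apply: bm_comp => //; case: (preserves_iter k pS).
have b2 k : bounded_measurable (fun w => f (iter k.+1 S' w)).
  by apply: bm_comp => //; case: (preserves_iter k.+1 pS').
have b := bmD (bm_sum n.+1 b1) (bm_sum n b2).
by have [] := bmZ (n.*2.+1%:R^-1) b; under eq_fun do rewrite mulrC.
Qed.

(** The window [[-n, n]] is covered by the forward and the backward windows, which share only time
    0; normalizing by [2n + 1] instead of [2n + 2] costs at most [1 / (n + 1)]. *)
Lemma two_sided_le_average S S' n f w : in01 f -> two_sided S S' n f w <=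
  2^-1 * (average S n f w + average S' n f w) + n.+1%:R^-1.
Proof.
move=> f01; rewrite /two_sided ler_pdivrMr // mulrDl.
have a01 := in01_average S n w f01; have a01' := in01_average S' n w f01.
have n0 : 0 < (n.+1%:R : R) by rewrite ltr0n.
have sE (V : Omega -> Omega) :
    \sum_(k < n.+1) f (iter k V w) = average V n f w * n.+1%:R.
  by rewrite /average divfK ?gt_eqF.
have sE' : \sum_(k < n) f (iter k.+1 S' w) <= average S' n f w * n.+1%:R.
  rewrite -sE big_ord_recl lerDr; by case/andP: (f01 (iter (ord0 : 'I_n.+1) S' w)).
rewrite sE; apply: le_trans (lerD (lexx _) sE') _.
have <- : 2 * n.+1%:R - 1 = n.*2.+1%:R :> R.
  by rewrite -muln2 -[n.+1]addn1 -[(n * 2).+1]addn1 !natrD natrM; ring.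
move: a01 a01'; set a := average S n f w; set b := average S' n f w.
set N : R := n.+1%:R => a01 a01'.
have -> : N^-1 * (2 * N - 1) = 2 - N^-1 by field; rewrite gt_eqF.
have : N^-1 <= 1 by rewrite invf_le1 // ler1n.
move: (N^-1) a01 a01' => x; clearbody a b N; nra.
Qed.

(** The upper limit is at most half the sum of the forward and backward upper limits, each of mean
    at most [mean f]. *)
Lemma mean_limsup_two_sided S S' f : preserves P S -> preserves P S' ->
  in01 f -> measurable_fun [set: Omega] f ->
  mean (limsup_fun (fun n => two_sided S S' n f)) <= mean f.
Proof.
move=> pS pS' f01 mf.
have a01 V n : in01 (average V n f) by move=> w; exact: in01_average.
have bL V : preserves P V -> bounded_measurable (limsup_fun (fun n => average V n f)).
  move=> pV; apply: bm_in01; last exact: in01_limsup_fun.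
  by apply: measurable_limsup_fun => // n; exact: (measurable_average (P := P)).
have t01 n : in01 (two_sided S S' n f) by exact: in01_two_sided.
have h w : limsup_fun (fun n => two_sided S S' n f) w <=
    2^-1 * (limsup_fun (fun n => average S n f) w +
            limsup_fun (fun n => average S' n f) w).
  rewrite /limsup_fun; set l := limn_sup (fun n => average S n f w).
  set l' := limn_sup (fun n => average S' n f w).
  apply: limn_sup_le => [n|e e0]; first exact: t01.
  have e20 : 0 < e / 2 by rewrite divr_gt0.
  near=> n.
  have h1 : average S n f w <= (l : R) + e / 2.
    by near: n; apply: near_le_limn_sup => // n; exact: a01.
  have h2 : average S' n f w <= (l' : R) + e / 2.
    by near: n; apply: near_le_limn_sup => // n; exact: a01.
  have h3 : 1 / n.+1%:R < e / 2 by near: n; exact: near_natV_lt.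
  apply: le_trans (two_sided_le_average S S' n w f01) _.
  move: h1 h2 h3; rewrite div1r.
  by move: (l : R) (l' : R) (n.+1%:R^-1 : R) => x y z; lra.
have bS := bL S pS; have bS' := bL S' pS'.
apply: (@le_trans _ _ (2^-1 * (mean f + mean f))); last by lra.
apply: (@le_trans _ _ (mean (fun w => 2^-1 * (limsup_fun (fun n => average S n f) w +
            limsup_fun (fun n => average S' n f) w)))).
  apply: mean_le => //; last exact/bmZ/bmD.
  apply: bm_in01; last exact: in01_limsup_fun.
  by apply: measurable_limsup_fun => // n; exact: measurable_two_sided.
rewrite meanZ ?meanD //; last exact: bmD.
by rewrite ler_pM2l ?invr_gt0 // lerD // mean_limsup_average.
Unshelve. all: by end_near. Qed.

Lemma two_sided_shift S S' n f w : in01 f -> S' (S w) = w ->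
  `|two_sided S S' n f (S w) - two_sided S S' n f w| <= n.+1%:R^-1.
Proof.
move=> f01 S'S.
rewrite /two_sided -mulrBl normrM [X in _ * X]ger0_norm ?invr_ge0 //.
apply: (@le_trans _ _ (1 / n.*2.+1%:R)); last first.
  by rewrite div1r lef_pV2 ?posrE ?ltr0n // ler_nat ltnS -addnn leq_addr.
rewrite ler_pM2r ?invr_gt0 //.
under eq_bigr do rewrite -iterSr.
(* The backward orbit of [S w] starts at [w], so this part telescopes too, and only
   [f (iter n.+1 S w)] and [f (iter n S' w)] survive. *)
under [X in _ + X - _]eq_bigr do rewrite iterSr S'S.
rewrite opprD addrACA -!sumrB.
rewrite -(big_mkord predT (fun k => f (iter k.+1 S w) - f (iter k S w))).
rewrite -(big_mkord predT (fun k => f (iter k S' w) - f (iter k.+1 S' w))).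
rewrite telescope_sumr // [X in _ + X](_ : _ =
    - \sum_(0 <= k < n) (f (iter k.+1 S' w) - f (iter k S' w))); last first.
  by rewrite -sumrN; apply: eq_bigr => k _; rewrite opprB.
rewrite telescope_sumr // ler_norml.
have := f01 (iter n.+1 S w); have := f01 (iter n S' w).
move: (f (iter n.+1 S w)) (f (iter n S' w)) => x y.
by rewrite /=; lra.
Qed.

End two_sided.

(** * Averages over boxes for two commuting maps *)

Section box_average.
Context {R : realType} {d : measure_display} {Omega : measurableType d}.
Variable P : probability Omega R.
Variables (S1 S1' S2 S2' : Omega -> Omega).
Hypotheses (pS1 : preserves P S1) (pS1' : preserves P S1').
Hypotheses (pS2 : preserves P S2) (pS2' : preserves P S2').
Hypotheses (S1K : cancel S1 S1') (S2K : cancel S2 S2').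
Hypotheses (S12 : forall w, S1 (S2 w) = S2 (S1 w)).
Hypotheses (S1'2 : forall w, S1' (S2 w) = S2 (S1' w)).
Hypothesis erg : forall A, measurable A -> S1 @^-1` A = A -> S2 @^-1` A = A ->
  P A = 0%E \/ P A = 1%E.

Local Notation mean f := (Rintegral P [set: Omega] f).

Definition box_average (n : nat) (f : Omega -> R) : Omega -> R :=
  two_sided S1 S1' n (two_sided S2 S2' n f).

Section unit_function.
Variable f : Omega -> R.
Hypotheses (f01 : in01 f) (mf : measurable_fun [set: Omega] f).

Let limsup_box := limsup_fun (fun n => box_average n f).

Lemma in01_box_average n : in01 (box_average n f).
Proof. by do 2! apply: in01_two_sided. Qed.

Let measurable_col n : measurable_fun [set: Omega] (two_sided S2 S2' n f).
Proof. exact: (measurable_two_sided (P := P)). Qed.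

Lemma measurable_box_average n : measurable_fun [set: Omega] (box_average n f).
Proof.
by apply: (measurable_two_sided (P := P)) => //; exact: in01_two_sided.
Qed.

Let bm_limsup_box : bounded_measurable limsup_box.
Proof.
apply: bm_in01; last by apply: in01_limsup_fun => n; exact: in01_box_average.
apply: measurable_limsup_fun => n; first exact: in01_box_average.
exact: measurable_box_average.
Qed.

(* For [n >= m] the inner average is at most its supremum over all sizes
   [>= m], so the one-dimensional bound applies in each direction in turn. *)
Lemma mean_limsup_box_average : mean limsup_box <= mean f.
Proof.
pose F m w := sups (fun n => two_sided S2 S2' n f w) m.
have c01 w : in01 (fun n => two_sided S2 S2' n f w).
  by move=> n; exact: in01_two_sided.
have F01 m : in01 (F m) by move=> w; exact: in01_sups.
have mF m : measurable_fun [set: Omega] (F m).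
  by apply: measurable_fun_sups => // w _; exact: in01_has_ubound.
have le_F m : mean limsup_box <= mean (F m).
  apply: le_trans (mean_limsup_two_sided pS1 pS1' (F01 m) (mF m)).
  apply: mean_le => //.
    apply: bm_in01; last by apply: in01_limsup_fun => n; exact: in01_two_sided.
    apply: measurable_limsup_fun => n; first exact: in01_two_sided.
    exact: (measurable_two_sided (P := P)).
  move=> w; apply: limn_sup_le => [n|e e0]; first exact: in01_box_average.
  near=> n.
  have h : two_sided S1 S1' n (F m) w <=
      (limn_sup (fun n => two_sided S1 S1' n (F m) w) : R) + e.
    by near: n; apply: near_le_limn_sup => // n; exact: in01_two_sided.
  apply: le_trans h; apply: two_sided_le => v; apply: le_sups => //.
  by near: n; exists m.
(* As [m] grows, [F m] decreases to the upper limit of the inner averages, to which the bound in the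
   second direction applies. *)
have cF : (fun m => mean (F m)) @ \oo -->
    mean (limsup_fun (fun n => two_sided S2 S2' n f)).
  apply: (@mean_cvg _ _ _ _ _ _ 1) => //.
  - by move=> m w; case/andP: (F01 m w) => F0 F1; rewrite ger0_norm.
  - apply: bm_in01; last by apply: in01_limsup_fun => n; exact: in01_two_sided.
    by apply: measurable_limsup_fun => n; first exact: in01_two_sided.
  - by move=> w; exact: cvg_sups_limn_sup.
apply: le_trans (mean_limsup_two_sided pS2 pS2' f01 mf).
rewrite -(cvg_lim _ cF) //; apply: limr_ge; last exact: nearW.
by apply/cvg_ex; eexists; exact: cF.
Unshelve. all: by end_near. Qed.

(** [S1] shifts the outer average. [S2] commutes with the outer maps, so it changes every inner
    average by at most [1 / (n + 1)], a uniform bound that the outer average preserves. *)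
Lemma limsup_box_average_invariant w :
  limsup_box (S1 w) = limsup_box w /\ limsup_box (S2 w) = limsup_box w.
Proof.
have b01 v : in01 (fun n => box_average n f v).
  by move=> n; exact: in01_box_average.
split; apply: limn_sup_near_eq => // n.
  by apply: two_sided_shift; [exact: in01_two_sided|exact: S1K].
have S1i k v : iter k S1 (S2 v) = S2 (iter k S1 v).
  by elim: k => //= k ->.
have S1'i k v : iter k S1' (S2 v) = S2 (iter k S1' v).
  by elim: k => //= k ->.
rewrite /box_average.
have -> : two_sided S1 S1' n (two_sided S2 S2' n f) (S2 w) =
    two_sided S1 S1' n (fun v => two_sided S2 S2' n f (S2 v)) w.
  rewrite {1 3}/two_sided; congr ((_ + _) / _); apply: eq_bigr => k _.
    by rewrite S1i.
  by rewrite S1'i.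
rewrite -two_sidedB; set g := fun v => _ - _.
have g1 v : `|g v| <= n.+1%:R^-1 by apply: two_sided_shift.
have [gl gr] : (forall v, - n.+1%:R^-1 <= g v) /\ (forall v, g v <= n.+1%:R^-1).
  by split => v; have := g1 v; rewrite ler_norml => /andP[].
rewrite ler_norml -{1}(two_sided_cst S1 S1' n (- n.+1%:R^-1) w).
rewrite -[X in _ && (_ <= X)](two_sided_cst S1 S1' n n.+1%:R^-1 w).
by rewrite !two_sided_le.
Qed.

(** By ergodicity the invariant event that the upper limit exceeds [mean f + 1 / (k + 1)] has
    probability 0 or 1; probability 1 would push the mean of the upper limit above [mean f]. *)
Lemma limsup_box_average_le : {ae P, forall w, limsup_box w <= mean f}.
Proof.
have [mL _] := bm_limsup_box.
have half k : {ae P, forall w, limsup_box w <= mean f + k.+1%:R^-1}.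
  pose A := [set w | mean f + k.+1%:R^-1 < limsup_box w].
  have mA : measurable A.
    have := mL measurableT _ (measurable_itv `]mean f + k.+1%:R^-1, +oo[).
    rewrite setTI; congr measurable; apply/seteqP.
    by split => w /=; rewrite in_itv /= andbT.
  have A1 : S1 @^-1` A = A.
    by apply/seteqP; split => w; rewrite /A /= (limsup_box_average_invariant w).1.
  have A2 : S2 @^-1` A = A.
    by apply/seteqP; split => w; rewrite /A /= (limsup_box_average_invariant w).2.
  have [PA0|PA1] := erg mA A1 A2.
  - exists A; split => // w /= /negP; rewrite -ltNge; exact.
  - exfalso; have k0 : 0 < (k.+1%:R^-1 : R) by rewrite invr_gt0 ltr0n.
    suff : mean f + k.+1%:R^-1 <= mean limsup_box.
      by move=> /le_trans/(_ mean_limsup_box_average); rewrite gerDl leNgt k0.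
    have f0 : 0 <= mean f by apply: Rintegral_ge0 => v _; case/andP: (f01 v).
    have bA := bm_indic (R := R) mA.
    have -> : mean f + k.+1%:R^-1 = mean (fun w => (mean f + k.+1%:R^-1) * \1_A w).
      by rewrite meanZ // mean_indic // PA1 mulr1.
    apply: mean_le => // [|w]; first exact: bmZ.
    rewrite indicE; have [/set_mem/ltW|_] := boolP (w \in A).
      by rewrite mulr1.
    rewrite mulr0; have /(_ w)/andP[] // : in01 limsup_box.
    by apply: in01_limsup_fun => n; exact: in01_box_average.
apply: filterS (ae_foralln half) => w h; apply/ler_addgt0Pr => e e0.
have [N _ /(_ N (leqnn N))] := near_natV_lt 1 e0; rewrite div1r => hN.
by apply: le_trans (h N) _; rewrite lerD2l ltW.
Qed.

End unit_function.

(** The box averages of [A] and of its complement add up to 1, so the upper bound for the complement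
    is a lower bound for [A]. *)
Lemma box_average_indic_cvg (A : set Omega) : measurable A ->
  {ae P, forall w, (fun n => box_average n (\1_A) w) @ \oo --> fine (P A)}.
Proof.
move=> mA.
have indic01 (B : set Omega) : in01 (\1_B : Omega -> R).
  by move=> w; rewrite indicE; case: (_ \in _); rewrite ?lexx ler01.
have mI (B : set Omega) : measurable B ->
    measurable_fun [set: Omega] (\1_B : Omega -> R).
  by move=> mB; exact: measurable_indic.
have compl n w : box_average n (\1_(~` A)) w = 1 - box_average n (\1_A) w.
  have E : (\1_(~` A) : Omega -> R) = fun v => 1 - \1_A v.
    apply/funext => v; rewrite !indicE in_setC.
    by case: (_ \in _); rewrite /= ?subrr ?subr0.
  rewrite E /box_average -{2}(two_sided_cst S1 S1' n 1 w) -two_sidedB.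
  congr two_sided; apply/funext => v.
  by rewrite two_sidedB two_sided_cst.
have hA := limsup_box_average_le (indic01 A) (mI _ mA).
have hC := limsup_box_average_le (indic01 (~` A)) (mI _ (measurableC mA)).
apply: filterS2 hA hC => w; rewrite /limsup_fun !mean_indic //; last exact: measurableC.
have -> : fine (P (~` A)) = 1 - fine (P A).
  by rewrite probability_setC // fineB // fin_num_measure.
move=> hA hC; apply/cvgrPdist_le => e e0; near=> n.
have h1 : box_average n (\1_A) w <=
    (limn_sup (fun n => box_average n (\1_A : Omega -> R) w) : R) + e.
  by near: n; apply: near_le_limn_sup => // n; exact: in01_box_average.
have h2 : box_average n (\1_(~` A)) w <=
    (limn_sup (fun n => box_average n (\1_(~` A) : Omega -> R) w) : R) + e.
  by near: n; apply: near_le_limn_sup => // n; exact: in01_box_average.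
move: h1 h2 => /le_trans/(_ (lerD hA (lexx e))) h1.
move=> /le_trans/(_ (lerD hC (lexx e))); rewrite compl ler_norml => h2.
by move: h1 h2; lra.
Unshelve. all: by end_near. Qed.

End box_average.

(** * Counting lattice points in boxes *)

Section counting.
Context {R : realType}.

(** Listed in the order in which [two_sided] sums: times 0 to [n] forward, then 1 to [n]
    backward. *)
Definition int_range (n : nat) : seq int :=
  [seq k%:Z | k <- iota 0 n.+1] ++ [seq - k.+1%:Z | k <- iota 0 n].

Lemma mem_int_range n i : (i \in int_range n) = (`|i| <= n%:Z).
Proof.
rewrite mem_cat; apply/orP/idP => [[]/mapP[k]|].
- rewrite mem_iota => kn ->; lia.
- rewrite mem_iota => kn ->; lia.
case: i => k kn; [left|right]; apply/mapP; exists k.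
- rewrite mem_iota; lia.
- by [].
- rewrite mem_iota; lia.
- by rewrite NegzE.
Qed.

Lemma uniq_int_range n : uniq (int_range n).
Proof.
rewrite cat_uniq !map_inj_uniq ?iota_uniq ?andbT /=; last 2 first.
- by move=> i j; lia.
- by move=> i j; lia.
by apply/hasPn => _ /mapP[k _ ->]; apply/negP => /mapP[l _]; lia.
Qed.

Lemma card_fset_set_seq (T : choiceType) (A : set T) (s : seq T) :
  uniq s -> (forall z, (z \in s) <-> A z) -> #|` fset_set A| = size s.
Proof.
move=> us sA; have fA : finite_set A.
  by apply/finite_seqP; exists s; apply/seteqP; split => z /= /sA.
apply/perm_size/uniq_perm => // z; rewrite in_fset_set //.
by apply/idP/idP => [/set_mem/sA//|/sA h]; apply/mem_set.
Qed.

Lemma card_box (A : set Z2) n : (#|` fset_set (A `&` box n)|)%:R =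
  \sum_(i <- int_range n) \sum_(j <- int_range n) (\1_A (i, j) : R).
Proof.
pose s := [seq (i, j) | i <- int_range n, j <- int_range n].
rewrite (@card_fset_set_seq _ _ [seq z <- s | z \in A]).
- rewrite size_filter -sum1_count natr_sum big_mkcond /=.
  rewrite /s big_allpairs; apply: eq_bigr => i _; apply: eq_bigr => j _.
  by rewrite indicE; case: (_ \in _).
- apply/filter_uniq/allpairs_uniq; rewrite ?uniq_int_range //.
  by move=> [? ?] [? ?] _ _.
- move=> [i j]; rewrite mem_filter; split.
    move=> /andP[/set_mem Aij /allpairsP[[i' j'] /= [i'n j'n e]]].
    move: Aij; rewrite e => Aij.
    by split => //; split; rewrite /= -mem_int_range.
  move=> [Aij [/= i_n j_n]]; rewrite mem_set //=; apply/allpairsP.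
  by exists (i, j); rewrite /= !mem_int_range.
Qed.

End counting.

(** * Densities for ergodic actions of the lattice *)

Section action.
Context {R : realType} {d : measure_display} {Omega : measurableType d}.
Variables (P : probability Omega R) (T : Z2 -> Omega -> Omega).
Hypothesis T_mp : measure_preserving_action P T.

Lemma action0 w : T 0 w = w.
Proof. by case: T_mp => ->. Qed.

Lemma actionD x y w : T (x + y) w = T x (T y w).
Proof. by case: T_mp => _ ->. Qed.

Lemma actionK x w : T (- x) (T x w) = w.
Proof. by rewrite -actionD addNr action0. Qed.

Lemma preserves_action z : preserves P (T z).
Proof. by case: T_mp => _ _ mT PT; split => // A mA; exact: PT. Qed.

Lemma iter_action e k w : iter k (T e) w = T (e *+ k) w.
Proof.
by elim: k => [|k IH]; rewrite ?action0 // iterS IH -actionD mulrS.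
Qed.

(** The additive map [e] stands for a coordinate embedding of the integers into [Z2]; it turns
    iterates of a generator into translations. *)
Lemma two_sided_action (e : int -> Z2) x y n (f : Omega -> R) w :
  (forall i j, e (i + j) = e i + e j) -> e 1 = x -> e (- 1) = y ->
  two_sided (T x) (T y) n f w =
  (\sum_(i <- int_range n) f (T (e i) w)) / n.*2.+1%:R.
Proof.
move=> eD <- <-; have e0 : e 0 = 0.
  by apply: (addrI (e 0)); rewrite -eD !addr0.
have eM i k : e i *+ k = e (i * k%:Z).
  elim: k => [|k IH]; first by rewrite mulr0n mulr0 e0.
  by rewrite mulrS IH -eD intS mulrDr mulr1.
congr (_ / _); rewrite /int_range big_cat !big_map; congr (_ + _).
  rewrite -(big_mkord predT (fun k => f (iter k (T (e 1)) w))) /index_iota subn0.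
  by apply: eq_bigr => k _; rewrite iter_action eM mul1r.
rewrite -(big_mkord predT (fun k => f (iter k.+1 (T (e (-1))) w))) /index_iota subn0.
by apply: eq_bigr => k _; rewrite iter_action eM mulN1r.
Qed.

Lemma invariant_action (A : set Omega) : T (1, 0) @^-1` A = A ->
  T (0, 1) @^-1` A = A -> forall z, T z @^-1` A = A.
Proof.
have main e : T e @^-1` A = A -> forall i : int, T (e *~ i) @^-1` A = A.
  move=> eA; have nA (k : nat) : T (e *+ k) @^-1` A = A.
    elim: k => [|k IH].
      by apply/seteqP; split => w; rewrite /preimage /= mulr0n action0.
    rewrite -[RHS]IH -[in RHS]eA; apply/seteqP.
    by split => w; rewrite /preimage /= mulrS actionD.
  case=> k; first exact: nA.
  rewrite -[in LHS](nA k.+1); apply/funext => w.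
  by rewrite /preimage /mkset -actionD -[e *~ _]/(- (e *+ k.+1)) addrN action0.
move=> /main A1 /main A2 [i j].
have -> : (i, j) = (1, 0) *~ i + (0, 1) *~ j :> Z2.
  have mE (e : Z2) (k : int) : e *~ k = (e.1 * k, e.2 * k).
    have nE (l : nat) : e *+ l = (e.1 * l%:Z, e.2 * l%:Z).
      elim: l => [|l IH]; first by rewrite mulr0n !mulr0.
      by rewrite mulrS IH intS !mulrDr !mulr1; case: e {IH}.
    case: k => k; first exact: nE.
    by rewrite /intmul nE NegzE !mulrN.
  by rewrite !mE /= !mul1r !mul0r; congr pair; rewrite /= ?addr0 ?add0r.
apply/seteqP; split => w; rewrite /preimage /= actionD.
  by move=> h; have : (T ((1, 0) *~ i) @^-1` A) (T ((0, 1) *~ j) w) := h;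
    rewrite A1 => h'; have : (T ((0, 1) *~ j) @^-1` A) w := h'; rewrite A2.
by rewrite -{1}(A2 j) /preimage /= -{1}(A1 i).
Qed.

(** The box average of [\1_A] along the two axes is the proportion of the [z] in the box for which
    [T z w] lies in [A]. *)
Lemma ergodic_density (A : set Omega) : ergodic P T -> measurable A ->
  {ae P, forall w, has_density [set z | A (T z w)] (fine (P A))}.
Proof.
move=> erg mA.
have pT := preserves_action.
have key := @box_average_indic_cvg _ _ _ P (T (1, 0)) (T (-1, 0)) (T (0, 1))
  (T (0, -1)) (pT _) (pT _) (pT _) (pT _).
have comm x y w : T x (T y w) = T y (T x w) by rewrite -!actionD addrC.
have : {ae P, forall w, (fun n => box_average (T (1, 0)) (T (-1, 0)) (T (0, 1))
    (T (0, -1)) n (\1_A) w) @ \oo --> fine (P A)}.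
  apply: key => //.
  - by move=> w; rewrite -[RHS](actionK (1, 0)).
  - by move=> w; rewrite -[RHS](actionK (0, 1)).
  - by move=> B mB B1 B2; apply: erg => //; exact: invariant_action.
apply: filterS => w; rewrite /has_density.
set F := fun n => box_average _ _ _ _ n _ _; set G := fun N => _ / _.
suff -> : G = F by [].
apply/funext => n; rewrite /F /G card_box /box_average.
have D1 (i j : int) : (i + j, 0) = (i, 0) + (j, 0) :> Z2.
  by congr pair; rewrite addr0.
have D2 (i j : int) : (0, i + j) = (0, i) + (0, j) :> Z2.
  by congr pair; rewrite addr0.
rewrite (two_sided_action _ _ _ D1 erefl erefl).
under [in RHS]eq_bigr do rewrite (two_sided_action _ _ _ D2 erefl erefl).
rewrite -mulr_suml -mulrA -invfM -natrM; congr (_ / _).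
apply: eq_bigr => i _; apply: eq_bigr => j _.
rewrite !indicE; congr (_%:R); rewrite -actionD.
have -> : (0, j) + (i, 0) = (i, j) :> Z2 by congr pair; rewrite /= ?addr0 ?add0r.
by congr nat_of_bool; apply/idP/idP => /set_mem h; apply/mem_set.
Qed.

End action.

(** * Exit points and boundary points *)

Section configuration.
Context {d : measure_display} {Omega : measurableType d}.
Variables (W : Omega -> set Z2) (X : Z2 -> Omega -> nat -> Z2) (w : Omega).

Definition exit_point (z : Z2) : Prop :=
  W w z /\ forall k, (0 < k)%N -> z.1 < (X z w k).1.

Definition boundary (b : Z2) : Prop := exit_point b /\
  forall m, exit_point m -> m.1 = b.1 -> m.2 < b.2 -> ~ coalesce X w m b.

(** Only countable quantifiers occur, so this event is measurable; for compatible nearest-neighbor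
    walks it describes the bi-infinite points of [W w]. *)
Definition reached_late (z : Z2) : Prop :=
  forall n, exists a k, [/\ (n <= k)%N, W w a & X a w k = z].

(** Otherwise the lower of the two would be an exit point below the other that coalesces with it. *)
Lemma boundary_inj b c : boundary b -> boundary c -> b.1 = c.1 ->
  coalesce X w b c -> b = c.
Proof.
suff h x y : boundary x -> boundary y -> x.1 = y.1 -> coalesce X w x y ->
    ~ x.2 < y.2.
  move=> bb bc e1 bc_co; have cb_co : coalesce X w c b.
    by case: bc_co => k [l kl]; exists l, k.
  have := h b c bb bc e1 bc_co; have := h c b bc bb (esym e1) cb_co.
  move: e1; case: b {bb bc_co cb_co} => b1 b2; case: c {bc} => c1 c2 /= -> n1 n2.
  by congr pair; lia.
by move=> [ex _] [_ hy] e co xy; apply: (hy x).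
Qed.

Hypothesis X_nn : nearest_neighbor_walks W X.

Lemma walk_column_le z k : W w z -> (X z w k).1 <= z.1 + k%:Z.
Proof.
move=> Wz; have [z0 step] := X_nn Wz; elim: k => [|k IH]; first by rewrite z0 addr0.
by have := step k; rewrite /Defs.adjacent; lia.
Qed.

Hypothesis compat : compatible_at W X w.

Lemma walk_mem z k : W w z -> W w (X z w k).
Proof.
elim: k z => [|k IH] z Wz; first by have [-> _] := X_nn Wz.
by have [W1 ->] := compat k Wz; exact: IH.
Qed.

Lemma walkD z k l : W w z -> X z w (k + l) = X (X z w k) w l.
Proof.
elim: k z => [|k IH] z Wz; first by have [-> _] := X_nn Wz.
by have [W1 e] := compat k Wz; have [_ ->] := compat (k + l) Wz; rewrite e IH.
Qed.

Lemma coalesce_sym x y : coalesce X w x y -> coalesce X w y x.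
Proof. by case=> k [l kl]; exists l, k. Qed.

Lemma coalesce_trans x y z : W w x -> W w y -> W w z ->
  coalesce X w x y -> coalesce X w y z -> coalesce X w x z.
Proof.
(* Of [x] and [z], the one whose walk joins that of [y] first is run on until the later of the
   joining times [l] and [m]. *)
move=> Wx Wy Wz [k [l kl]] [m [n mn]]; case: (leqP l m) => lm.
  exists (k + (m - l))%N, n; rewrite walkD // kl -walkD // subnKC //.
exists k, (n + (l - m))%N; rewrite [RHS]walkD // -mn -walkD // subnKC //.
exact: ltnW.
Qed.

Lemma bi_infinite_reached_late z : W w z -> bi_infinite W X w z -> reached_late z.
Proof.
move=> Wz [a [Wa a0 step]] [|n].
  by exists z, 0%N; split => //; have [-> //] := X_nn Wz.
by exists (a n.+1), n.+1; split => //; rewrite step // subnn.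
Qed.

Lemma reached_late_mem z : reached_late z -> W w z.
Proof. by move=> /(_ 0%N) [a [k [_ Wa <-]]]; exact: walk_mem. Qed.

(* Only the four neighbors of [z] can be its predecessors. *)
Lemma reached_late_pred z : reached_late z ->
  exists2 y, reached_late y & X y w 1%N = z.
Proof.
move=> late; apply: contrapT => none.
pose nb (i : 'I_4) : Z2 :=
  nth (0, 0) [:: (z.1 + 1, z.2); (z.1 - 1, z.2); (z.1, z.2 + 1); (z.1, z.2 - 1)] i.
(* If no neighbor is a suitable predecessor, each one has a threshold: when reached at or after that
   time, it does not step to [z]. *)
have early i : exists n, forall a k, (n <= k)%N -> W w a -> X a w k = nb i ->
    X (nb i) w 1%N <> z.
  apply: contrapT => /forallNP h; apply: none; exists (nb i).
    move=> n; have /existsNP[a /existsNP[k]] := h n.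
    by move=> /not_implyP[nk /not_implyP[Wa /not_implyP[ak _]]]; exists a, k.
  have /existsNP[a /existsNP[k]] := h 0%N.
  move=> /not_implyP[_ /not_implyP[Wa /not_implyP[ak /contrapT]]]; exact.
have [n hn] := choice early.
(* The successor makes the arrival time positive and leaves the preceding point at or beyond all
   four thresholds. *)
have [a [[|k] [nk Wa ak]]] := late (\max_i n i).+1; first by [].
have Wk := walk_mem k Wa; have [_ step] := X_nn Wa.
have [i nbi] : exists i, X a w k = nb i.
  have := step k; rewrite ak /Defs.adjacent /nb; move: (X a w k) => [x1 x2] /= adj.
  have [[-> ->]|[[-> ->]|[[-> ->]|[-> ->]]]] : (x1 = z.1 + 1 /\ x2 = z.2) \/
    (x1 = z.1 - 1 /\ x2 = z.2) \/ (x1 = z.1 /\ x2 = z.2 + 1) \/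
    (x1 = z.1 /\ x2 = z.2 - 1) by lia.
  - by exists (inord 0); rewrite inordK.
  - by exists (inord 1); rewrite inordK.
  - by exists (inord 2); rewrite inordK.
  - by exists (inord 3); rewrite inordK.
apply: (hn i a k) => //; first by apply: leq_trans (leq_bigmax i) nk.
by rewrite -nbi -walkD // addn1.
Qed.

(** Koenig's argument: predecessors that are again reached late are chosen repeatedly, by a choice
    function on the subtype of such points. *)
Lemma reached_late_bi_infinite z : reached_late z -> bi_infinite W X w z.
Proof.
move=> late; pose S := {y | reached_late y}.
have next (s : S) : exists t : S, X (sval t) w 1%N = sval s.
  by have [y ly e] := reached_late_pred (svalP s); exists (exist _ y ly).
have [f hf] := choice next.
pose a n := sval (iter n f (exist _ z late : S)).
have aW n : W w (a n) by apply: reached_late_mem; exact: svalP.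
exists a; split => // n i _; elim: i => [|i IH] i_n.
  by rewrite subn0; have [-> _] := X_nn (aW n).
rewrite -addn1 walkD // IH ?(ltnW i_n) // -(subnSK i_n) /a iterS hf.
by rewrite addn1.
Qed.

Hypothesis cross : forall z, W w z -> last_crossings X w z.

(** The place of the last crossing of the column is such a point. *)
Lemma exit_exists z a : W w z -> z.1 < a ->
  exists k, exit_point (X z w k) /\ (X z w k).1 = a.
Proof.
move=> Wz za; have [k [ka right]] := cross Wz za; exists k; split => //.
split; first exact: walk_mem.
move=> l l0; rewrite -walkD // ka; apply: right.
by rewrite -[k in (k < _)%N]addn0 ltn_add2l.
Qed.

(** By planarity the walk of [m] meets that of [b] or that of [c], and these two belong to one
    class. *)
Lemma coalesce_between b m c : exit_point b -> exit_point m -> exit_point c ->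
  b.1 = c.1 -> m.1 = c.1 -> b.2 < m.2 < c.2 -> coalesce X w b c ->
  coalesce X w m c.
Proof.
move=> [Wb xb] [Wm xm] [Wc xc] bc mc /andP[bm mc2] [i [j ij]].
have [b0 sb] := X_nn Wb; have [m0 sm] := X_nn Wm; have [c0 sc] := X_nn Wc.
have [rb rm rc] : [/\ (X b w 0%N).1 = c.1, (X m w 0%N).1 = c.1 &
  (X c w 0%N).1 = c.1] by rewrite b0 m0 c0.
have xb' k (k0 : (0 < k)%N) : c.1 < (X b w k).1 by rewrite -bc; exact: xb.
have xm' k (k0 : (0 < k)%N) : c.1 < (X m w k).1 by rewrite -mc; exact: xm.
have ord : (X b w 0%N).2 < (X m w 0%N).2 < (X c w 0%N).2.
  by rewrite b0 m0 c0 bm.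
have escape x : exists k, x < (X m w k).1.
  have ma : m.1 < Num.max x m.1 + 1 by lia.
  by have [k [kx _]] := cross Wm ma; exists k; rewrite kx; lia.
have [k [l [kl|kl]]] := sandwiched_path_meets sb sm sc rb rm rc xb' xm' xc ord ij escape.
- apply: (@coalesce_trans _ b) => //; last by exists i, j.
  by exists k, l.
- by exists k, l.
Qed.

Lemma boundary_exists x y : W w x -> W w y -> ~ coalesce X w x y ->
  exists b, boundary b.
Proof.
move=> Wx Wy nxy.
(* A column strictly to the right of both starting points, so that each walk has an exit point on
   it. *)
pose a := Num.max x.1 y.1 + 1.
have xa : x.1 < a by lia.
have ya : y.1 < a by lia.
have {xa} [k [ex xa]] := exit_exists Wx xa.
have {ya} [l [ey ya]] := exit_exists Wy ya.
have {nxy} nco : ~ coalesce X w (X x w k) (X y w l).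
  move=> [i [j ij]]; apply: nxy; exists (k + i)%N, (l + j)%N.
  by rewrite !walkD.
move: (X x w k) (X y w l) ex xa ey ya nco => {Wx Wy k l} p q.
suff h p' q' : exit_point p' -> p'.1 = a -> exit_point q' -> q'.1 = a ->
    ~ coalesce X w p' q' -> p'.2 < q'.2 -> exists b, boundary b.
  move=> ep pa eq qa nco; case: (ltgtP p.2 q.2) => pq.
  - exact: (h p q).
  - by apply: (h q p) => // /coalesce_sym.
  - exfalso; apply: nco; exists 0%N, 0%N; congr (X _ w 0%N).
    by rewrite [p]surjective_pairing [q]surjective_pairing pa qa pq.
move=> {p q} ep pa eq qa nco pq; move: p' q' ep pa eq qa nco pq => p q.
move=> ep pa eq qa nco pq.
(* The class of [q] is searched upward from the height of [p], which guarantees a lowest element. *)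
pose class n := `[< exit_point (a, p.2 + n%:Z) /\ coalesce X w (a, p.2 + n%:Z) q >].
have exc : exists n, class n.
  exists `|q.2 - p.2|%N; apply/asboolP.
  have -> : (a, p.2 + `|q.2 - p.2|%N) = q.
    by rewrite [RHS]surjective_pairing qa; congr pair; lia.
  by split => //; exists 0%N, 0%N.
case: (ex_minnP exc) => n /asboolP[en nq] nmin.
exists (a, p.2 + n%:Z); split => // m em /= ma mn mco.
have Wm : W w m by case: em.
have mq : coalesce X w m q.
  by apply: (coalesce_trans Wm _ _ mco nq); [case: en|case: eq].
case: (ltgtP p.2 m.2) => pm.
- have mE : (a, p.2 + `|m.2 - p.2|%N) = m.
    by rewrite [RHS]surjective_pairing ma; congr pair; lia.
  have := nmin `|m.2 - p.2|%N; rewrite /class mE => h.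
  have : (n <= `|m.2 - p.2|)%N by apply: h; apply/asboolP.
  lia.
(* A member of the class below [p] would sandwich [p] and make it coalesce with [q]. *)
- apply: nco; apply: (@coalesce_between m) => //; first by rewrite ma qa.
    by rewrite pa qa.
  by rewrite pm.
- apply: nco; have -> // : p = m.
  by rewrite [p]surjective_pairing [m]surjective_pairing pa ma pm.
Qed.
End configuration.

(** * Translation covariance of the configuration *)

Section shift.
Context {d : measure_display} {Omega : measurableType d}.
Variables (T : Z2 -> Omega -> Omega) (W : Omega -> set Z2).
Variables (X : Z2 -> Omega -> nat -> Z2) (w : Omega) (x : Z2).
Hypothesis W_cov : translation_covariant T W.
Hypothesis stat : stationary_at T W X w.

Let fstD (y z : Z2) : (y + z).1 = y.1 + z.1. Proof. by []. Qed.
Let sndD (y z : Z2) : (y + z).2 = y.2 + z.2. Proof. by []. Qed.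

Lemma W_shift y : W (T x w) y <-> W w (y + x).
Proof.
rewrite W_cov; split => [[z Wz <-]|Wyx]; first by rewrite subrK.
by exists (y + x); rewrite ?addrK.
Qed.

Lemma walk_shift y k : W w (y + x) -> X (y + x) w k = x + X y (T x w) k.
Proof. by move=> Wyx; rewrite (stat x k Wyx) addrK. Qed.

Lemma exit_shift y : exit_point W X (T x w) y <-> exit_point W X w (y + x).
Proof.
have step k : W w (y + x) ->
    ((y + x).1 < (X (y + x) w k).1) = (y.1 < (X y (T x w) k).1).
  by move=> Wyx; rewrite walk_shift // [x + _]addrC !fstD ltrD2r.
split=> -[Wy right]; split; try exact/W_shift.
  by move=> k k0; rewrite step; [exact: right|exact/W_shift].
by move=> k k0; rewrite -step //; exact: right.
Qed.

Lemma coalesce_shift y z : W w (y + x) -> W w (z + x) ->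
  coalesce X (T x w) y z <-> coalesce X w (y + x) (z + x).
Proof.
move=> Wy Wz; split=> -[k [l kl]]; exists k, l; first by rewrite !walk_shift // kl.
by move: kl; rewrite !walk_shift // => /addrI.
Qed.

Lemma boundary_shift y : boundary W X (T x w) y <-> boundary W X w (y + x).
Proof.
split=> -[ey lowest]; have ey' := ey; move: ey' => /exit_shift ey'; split => // m em.
  move: em; rewrite -[m](subrK x) => /exit_shift em.
  rewrite !fstD !sndD => /addIr m1; rewrite ltrD2r => m2.
  have em' : exit_point W X w (m - x + x) by apply/exit_shift.
  have [[Wm _] [Wy _]] := (em', ey').
  move=> /(coalesce_shift Wm Wy); exact: lowest.
have em' : exit_point W X w (m + x) by apply/exit_shift.
move=> m1 m2 co; have [[Wm _] [Wy _]] := (em', ey).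
apply: (lowest (m + x)) => //; first by rewrite !fstD m1.
  by rewrite !sndD ltrD2r.
exact/coalesce_shift.
Qed.

Lemma reached_late_shift y :
  reached_late W X (T x w) y <-> reached_late W X w (y + x).
Proof.
split=> late n; have [a [k [nk Wa ak]]] := late n.
  have Wax : W w (a + x) by exact/W_shift.
  by exists (a + x), k; split => //; rewrite walk_shift // ak addrC.
exists (a - x), k; have Wax : W w (a - x + x) by rewrite subrK.
split => //; first exact/W_shift.
by apply: (addrI x); rewrite -walk_shift // subrK ak addrC.
Qed.

End shift.

(** * Measurability of the events *)

Section measurability.
Context {d : measure_display} {Omega : measurableType d}.

Lemma measurable_exists (I : countType) (F : I -> set Omega) :
  (forall i, measurable (F i)) -> measurable [set w | exists i, F i w].
Proof.
move=> mF; have -> : [set w | exists i, F i w] =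
    \bigcup_n (if pickle_inv n is Some i then F i else set0 : set Omega).
  apply/seteqP; split => w /= [i].
    by move=> Fi; exists (choice.pickle i) => //; rewrite pickleK_inv.
  by move=> _; case: pickle_inv => // j Fj; exists j.
by apply: bigcupT_measurable => n; case: pickle_inv.
Qed.

Lemma measurable_forall (I : countType) (F : I -> set Omega) :
  (forall i, measurable (F i)) -> measurable [set w | forall i, F i w].
Proof.
move=> mF; have -> : [set w | forall i, F i w] = ~` [set w | exists i, (~` F i) w].
  apply/seteqP; split => w /=; first by move=> h [i]; apply.
  by move=> h i; apply: contrapT => n; apply: h; exists i.
by apply/measurableC/measurable_exists => i; apply: measurableC.
Qed.

Lemma measurable_imply (Q : Prop) (A : set Omega) : measurable A ->
  measurable [set w | Q -> A w].
Proof.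
move=> mA; have [q|nq] := pselect Q.
  suff -> : [set w | Q -> A w] = A by [].
  by apply/seteqP; split => v /=; [exact|].
suff -> : [set w | Q -> A w] = setT by exact: measurableT.
by apply/seteqP; split => v //= _ /nq.
Qed.

Lemma measurable_conj (Q : Prop) (A : set Omega) : measurable A ->
  measurable [set w | Q /\ A w].
Proof.
move=> mA; have [q|nq] := pselect Q.
  suff -> : [set w | Q /\ A w] = A by [].
  by apply/seteqP; split => v /= => [[]|].
suff -> : [set w | Q /\ A w] = set0 by exact: measurable0.
by apply/seteqP; split => v /= => [[]|].
Qed.

Variables (W : Omega -> set Z2) (X : Z2 -> Omega -> nat -> Z2).
Hypothesis W_meas : measurable_random_set W.
Hypothesis X_meas : measurable_walks W X.

(** Membership [W w z] accompanies each condition on the walk, because [measurable_walks] speaks of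
    the walk on that event only. *)
Lemma measurable_visit z k (Q : Z2 -> Prop) :
  measurable [set w | W w z /\ Q (X z w k)].
Proof.
have -> : [set w | W w z /\ Q (X z w k)] =
    [set w | exists y, Q y /\ [set v | W v z /\ X z v k = y] w].
  apply/seteqP; split => w /=; first by move=> [? ?]; exists (X z w k).
  by move=> [y [Qy [Wz ->]]].
by apply: measurable_exists => y; apply: measurable_conj; exact: X_meas.
Qed.

Lemma measurable_exit z : measurable [set w | exit_point W X w z].
Proof.
have -> : [set w | exit_point W X w z] = [set w | W w z] `&`
    [set w | forall k, (0 < k)%N -> [set v | W v z /\ z.1 < (X z v k).1] w].
  apply/seteqP; split => w /= -[Wz h]; split => // k k0; last by case: (h k k0).
  by split => //; exact: h.
apply: measurableI; first exact: W_meas.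
apply: measurable_forall => k; apply: measurable_imply.
exact: (measurable_visit z k (fun y => z.1 < y.1)).
Qed.

Lemma measurable_coalesce y z :
  measurable [set w | [/\ W w y, W w z & coalesce X w y z]].
Proof.
have -> : [set w | [/\ W w y, W w z & coalesce X w y z]] =
    [set w | exists k, exists l, exists x, ([set v | W v y /\ X y v k = x] `&`
      [set v | W v z /\ X z v l = x]) w].
  apply/seteqP; split => w /=.
    by move=> [Wy Wz [k [l kl]]]; exists k, l, (X y w k).
  by move=> [k [l [x [[Wy yx] [Wz zx]]]]]; split => //; exists k, l; rewrite yx.
do 3 (apply: measurable_exists => ?).
by apply: measurableI; exact: X_meas.
Qed.

Lemma measurable_boundary b : measurable [set w | boundary W X w b].
Proof.
have -> : [set w | boundary W X w b] = [set w | exit_point W X w b] `&`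
    (* Membership of [m] and [b] in [W], which the exit conditions imply, is added so that
       coalescence becomes a measurable event. *)
    [set w | forall m, m.1 = b.1 -> m.2 < b.2 ->
      (~` ([set v | exit_point W X v m] `&`
        [set v | [/\ W v m, W v b & coalesce X v m b]])) w].
  apply/seteqP; split => w /= -[eb h]; split => //.
    by move=> m m1 m2 [em [_ _ co]]; exact: (h m).
  move=> m em m1 m2 co; apply: (h m m1 m2); split => //.
  by split => //; [case: em|case: eb].
apply: measurableI; first exact: measurable_exit.
apply: measurable_forall => m; do 2 apply: measurable_imply.
apply: measurableC; apply: measurableI; first exact: measurable_exit.
exact: measurable_coalesce.
Qed.

Lemma measurable_reached n z :
  measurable [set w | exists a k, [/\ (n <= k)%N, W w a & X a w k = z]].
Proof.
have -> : [set w | exists a k, [/\ (n <= k)%N, W w a & X a w k = z]] =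
    [set w | exists a, exists k, (n <= k)%N /\
      [set v | W v a /\ X a v k = z] w].
  apply/seteqP; split => w /= -[a [k]].
    by move=> [nk Wa ak]; exists a, k.
  by move=> [nk [Wa ak]]; exists a, k.
apply: measurable_exists => a; apply: measurable_exists => k.
by apply: measurable_conj; exact: X_meas.
Qed.

Lemma measurable_reached_late z : measurable [set w | reached_late W X w z].
Proof. by apply: measurable_forall => n; exact: measurable_reached. Qed.

End measurability.

(** * Almost sure comparison and mass transport *)

Section almost_everywhere.
Context {R : realType} {d : measure_display} {Omega : measurableType d}.
Variable P : probability Omega R.

Lemma ae_le_measure (A B : set Omega) : measurable A -> measurable B ->
  {ae P, forall w, A w -> B w} -> (P A <= P B)%E.
Proof.
move=> mA mB [N [mN PN hN]].
apply: (@le_trans _ _ (P (B `|` N))).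
  apply: le_measure; rewrite ?inE //; first exact: measurableU.
  move=> w Aw; have [Bw|nB] := pselect (B w); [by left|right; apply: hN].
  by move=> /(_ Aw).
by apply: le_trans (measureU2 _ _ _) _ => //; rewrite [X in (_ + X)%E]PN adde0.
Qed.

Lemma ae_eq_measure (A B : set Omega) : measurable A -> measurable B ->
  {ae P, forall w, A w <-> B w} -> P A = P B.
Proof.
move=> mA mB AB; apply/eqP; rewrite eq_le !ae_le_measure //.
  by apply: filterS AB => w [].
by apply: filterS AB => w [].
Qed.

Lemma ae_forall (I : countType) (Q : I -> set Omega) :
  (forall i, {ae P, forall w, Q i w}) -> {ae P, forall w, forall i, Q i w}.
Proof.
move=> h.
have : {ae P, forall w, forall n, if pickle_inv n is Some i then Q i w else True}.
  by apply: ae_foralln => n; case: pickle_inv => [i|]; [exact: h|exact: aeW].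
by apply: filterS => w hw i; have := hw (choice.pickle i); rewrite pickleK_inv.
Qed.

(** The events [F i] cover [A], so [P A] is at most the sum of [P (F i) = P (G i)], and disjointness
    turns this sum into the probability of the union of the [G i]. *)
Lemma mass_transport (I : countType) (A : set Omega) (F G : I -> set Omega) :
  measurable A -> (forall i, measurable (F i)) -> (forall i, measurable (G i)) ->
  {ae P, forall w, A w -> exists i, F i w} ->
  (forall i, P (F i) = P (G i)) ->
  (forall i j w, G i w -> G j w -> i = j) ->
  (P A <= P [set w | exists i, G i w])%E.
Proof.
move=> mA mF mG AF FG Gdisj.
pose code (H : I -> set Omega) n := if pickle_inv n is Some i then H i else set0.
have codeE H : [set w | exists i, H i w] = \bigcup_n code H n.
  rewrite /code; apply/seteqP; split => w /= [i].
    by move=> Hi; exists (choice.pickle i) => //; rewrite pickleK_inv.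
  by move=> _; case: pickle_inv => // j Hj; exists j.
have mcode H : (forall i, measurable (H i)) -> forall n, measurable (code H n).
  by move=> mH n; rewrite /code; case: pickle_inv.
apply: (@le_trans _ _ (P [set w | exists i, F i w])).
  by apply: ae_le_measure => //; exact: measurable_exists.
rewrite !codeE.
apply: (@le_trans _ _ (\sum_(0 <= n <oo) P (code F n))%E).
  apply: measure_sigma_subadditive => //; first exact: mcode.
  by apply: bigcupT_measurable; exact: mcode.
have -> : (fun n => \sum_(0 <= k < n) P (code F k))%E =
    (fun n => \sum_(0 <= k < n) P (code G k))%E.
  apply/funext => n; apply: eq_bigr => k _.
  by rewrite /code; case: pickle_inv.
rewrite measure_semi_bigcup //; first exact: mcode.
  move=> m n _ _ [w []]; rewrite /code.
  case em : (pickle_inv m) => [i|] //; case en : (pickle_inv n) => [j|] //.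
  move=> Gi Gj; have ij := Gdisj _ _ _ Gi Gj.
  have := @pickle_invK I m; rewrite em /= => <-.
  by have := @pickle_invK I n; rewrite en /= => <-; rewrite ij.
by apply: bigcupT_measurable; exact: mcode.
Qed.

End almost_everywhere.

(** * The probability that the origin is reached late *)

Section stationary_walks.
Context {R : realType} {d : measure_display} {Omega : measurableType d}.
Variables (P : probability Omega R) (T : Z2 -> Omega -> Omega).
Variables (W : Omega -> set Z2) (X : Z2 -> Omega -> nat -> Z2).
Hypothesis T_mp : measure_preserving_action P T.
Hypothesis W_meas : measurable_random_set W.
Hypothesis W_cov : translation_covariant T W.
Hypothesis X_meas : measurable_walks W X.
Hypothesis X_nn : nearest_neighbor_walks W X.
Hypothesis X_stat : {ae P, forall w, stationary_at T W X w}.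
Hypothesis X_compat : {ae P, forall w, compatible_at W X w}.
Hypothesis X_cross : {ae P, forall w, forall z, W w z -> last_crossings X w z}.

Lemma measure_shift (A B : set Omega) z : measurable A -> measurable B ->
  {ae P, forall w, B w <-> A (T z w)} -> P B = P A.
Proof.
move=> mA mB BA; have [_ _ mT PT] := T_mp; rewrite -[RHS](PT z) //.
apply: ae_eq_measure => //.
by have := mT z measurableT _ mA; rewrite setTI.
Qed.

Lemma measure_boundary z :
  P [set w | boundary W X w z] = P [set w | boundary W X w 0].
Proof.
apply: (@measure_shift _ _ z); try exact: measurable_boundary.
apply: filterS X_stat => w stat /=.
by have := boundary_shift z W_cov stat 0; rewrite add0r => h; split => /h.
Qed.

(* The boundary point [b] sends its mass to a point of the column [b.1 + n + 1]
   that it reaches; a point receives mass from at most one [b] per column. *)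
Lemma measure_boundary_le n : (P [set w | boundary W X w 0%R] <=
  P [set w | exists a k, [/\ (n <= k)%N, W w a & X a w k = 0%R]])%E.
Proof.
(* The column [n + 1] lies strictly to the right of the origin even for [n = 0], as [last_crossings]
   requires. *)
pose z (j : int) : Z2 := (n.+1%:Z, j).
have mV x y : measurable [set w | exists k, [set v | W v x /\ X x v k = y] w].
  by apply: measurable_exists => k; exact: X_meas.
pose F j := [set w | boundary W X w 0] `&`
  [set w | exists k, [set v | W v 0 /\ X 0 v k = z j] w].
pose G j := [set w | boundary W X w (- z j)] `&`
  [set w | exists k, [set v | W v (- z j) /\ X (- z j) v k = 0] w].
have mF j : measurable (F j) by apply: measurableI => //; exact: measurable_boundary.
have mG j : measurable (G j) by apply: measurableI => //; exact: measurable_boundary.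
apply: (@le_trans _ _ (P [set w | exists j, G j w])).
  apply: (@mass_transport _ _ _ _ _ _ F) => //.
  - exact: measurable_boundary.
  - apply: filterS X_cross => w cross b0; have W0 : W w 0 by case: b0 => -[].
    have [k [ke _]] := cross 0 W0 n.+1 isT.
    exists (X 0 w k).2; split => //; exists k.
    by split; rewrite // /z -ke -surjective_pairing.
  (* Translation by [- z j] turns mass sent from 0 to [z j] into mass sent from [- z j] to 0. *)
  - move=> j; apply/esym/(@measure_shift _ _ (- z j)) => //.
    apply: filterS X_stat => w stat.
    have bs := boundary_shift (- z j) W_cov stat 0.
    have Ws := W_shift w (- z j) W_cov 0.
    have Xs k := @walk_shift _ _ T W X w (- z j) stat 0 k.
    rewrite add0r in bs Ws Xs.
    split=> -[/bs b0 [k [/Ws W0 Xk]]]; split => //; exists k; split => //.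
      have W0' : W w (- z j) by apply/Ws.
      by apply: (addrI (- z j)); rewrite -Xs // Xk addNr.
    by have W0' : W w (- z j) by []; rewrite Xs // Xk addNr.
  - move=> i j w [bi [k [_ ki]]] [bj [l [_ lj]]].
    (* Both boundary points lie on the column [- (n + 1)] and their walks visit the origin, so they
       coalesce. *)
    have : - z i = - z j.
      apply: (boundary_inj bi bj) => //; exists k, l; by rewrite ki lj.
    by move=> /oppr_inj[].
apply: le_measure; rewrite ?inE.
- exact: measurable_exists.
- exact: measurable_reached.
move=> w [j [_ [k [Wz Xk]]]]; exists (- z j), k; split => //.
(* A nearest-neighbor walk needs at least [n + 1] steps to advance by [n + 1] columns. *)
by have := walk_column_le X_nn k Wz; rewrite Xk /=; lia.
Qed.

(** Continuity from above along the decreasing events [K n]. *)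
Lemma measure_boundary_le_reached_late : (P [set w | boundary W X w 0%R] <=
  P [set w | reached_late W X w 0%R])%E.
Proof.
pose K n := [set w | exists a k, [/\ (n <= k)%N, W w a & X a w k = 0]].
have -> : [set w | reached_late W X w 0] = \bigcap_n K n.
  by apply/seteqP; split => w h n; [move=> _; exact: h|exact: h].
have cK : P \o K @ \oo --> P (\bigcap_n K n).
  apply: nonincreasing_cvg_mu.
  - by apply: le_lt_trans (ltry 1); exact: probability_le1 (measurable_reached X_meas _ _).
  - by move=> n; exact: measurable_reached.
  - by apply: bigcapT_measurable => n; exact: measurable_reached.
  - move=> m n mn; apply/subsetPset => w [a [k [nk Wa ak]]].
    by exists a, k; split => //; exact: leq_trans nk.
rewrite -(cvg_lim _ cK) //; apply: lime_ge.
  by apply/cvg_ex; eexists; exact: cK.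
by apply: nearW => n; exact: measure_boundary_le.
Qed.

(** If the origin were almost never a boundary point, stationarity and countability would exclude
    boundary points everywhere, and [boundary_exists] would then give coalescence. *)
Lemma measure_boundary_gt0 : ~ almost_sure_coalescence P W X ->
  (0 < P [set w | boundary W X w 0%R])%E.
Proof.
move=> nco; rewrite lt0e measure_ge0 andbT; apply/eqP => b0; apply: nco.
have none : {ae P, forall w, forall z, ~ boundary W X w z}.
  apply: (@ae_forall _ _ _ _ _ (fun z w => ~ boundary W X w z)) => z.
  exists [set w | boundary W X w z]; split; first exact: measurable_boundary.
    by rewrite measure_boundary b0.
  by move=> w /contrapT.
near=> w => x y Wx Wy.
have nb : forall z, ~ boundary W X w z by near: w.
apply: contrapT => nxy.
have [b hb] : exists b, boundary W X w b.
  apply: (boundary_exists X_nn _ _ Wx Wy nxy); by near: w.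
exact: (nb b).
Unshelve. all: by end_near. Qed.

(** This presents the bi-infinite points as the translations that bring [w] into one measurable
    event, the form required by [ergodic_density]. *)
Lemma reached_late_pullback : {ae P, forall w,
  [set z | W w z /\ bi_infinite W X w z] =
  [set z | reached_late W X (T z w) 0]}.
Proof.
near=> w.
have stat : stationary_at T W X w by near: w.
have compat : compatible_at W X w by near: w.
apply/seteqP; split => z /=.
  move=> [Wz /(bi_infinite_reached_late X_nn Wz) late].
  by apply/(reached_late_shift z W_cov stat); rewrite add0r.
move=> /(reached_late_shift z W_cov stat); rewrite add0r => late.
split; first exact: reached_late_mem late.
exact: reached_late_bi_infinite.
Unshelve. all: by end_near. Qed.

End stationary_walks.

Theorem theorem2p5 (R : realType) (d : measure_display)
  (Omega : measurableType d) (P : probability Omega R)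
  (T : Z2 -> Omega -> Omega) (W : Omega -> set Z2)
  (X : Z2 -> Omega -> nat -> Z2)
  (T_mp : measure_preserving_action P T)
  (T_ergodic : ergodic P T)
  (W_meas : measurable_random_set W)
  (W_cov : translation_covariant T W)
  (W_pos : (0 < P [set w | W w 0%R])%E)
  (X_meas : measurable_walks W X)
  (X_nn : nearest_neighbor_walks W X)
  (X_stat : {ae P, forall w, stationary_at T W X w})
  (X_compat : {ae P, forall w, compatible_at W X w})
  (X_noloop : {ae P, forall w, forall z, W w z -> no_loops X w z})
  (X_cross : {ae P, forall w, forall z, W w z -> last_crossings X w z})
  (not_coalesce : ~ almost_sure_coalescence P W X) :
  {ae P, forall w, positive_density R [set z | W w z /\ bi_infinite W X w z]}.
Proof.
set late := [set w | reached_late W X w 0].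
have late_gt0 : (0 < P late)%E.
  apply: (lt_le_trans (measure_boundary_gt0 T_mp W_meas W_cov X_meas X_nn X_stat
    X_compat X_cross not_coalesce)).
  exact: (measure_boundary_le_reached_late T_mp).
have mlate : measurable late by exact: measurable_reached_late.
have dens := ergodic_density T_mp T_ergodic mlate.
have pull := reached_late_pullback W_cov X_nn X_stat X_compat.
(* The density is the constant [P late], the same for almost every configuration. *)
apply: filterS2 dens pull => w dens ->; exists (fine (P late)) => //.
by rewrite fine_gt0 // late_gt0 /=; apply: le_lt_trans (ltry 1); exact: probability_le1.
Qed.
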